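(* Let $d=d(n)=o(n)$ and let $A$ be the adjacency matrix of a $d$-regular graph on $n$ vertices. Let $0<\delta<s<1-\delta<1$ with $sn$ an integer, let $X$ be uniformly distributed on $\{x\in\{-1,1\}^n:|\{i:x_i=1\}|=sn\}$, and put $\mathcal{A}(X)=\frac12X^{\intercal}AX$, $\sigma_s^2=\mathrm{var}(\mathcal{A}(X))$ and $L=\frac{\mathcal{A}(X)-\mathbb{E}\mathcal{A}(X)}{\sigma_s}$. Then: 1. $\sigma_s^2=8nds^2(1-s)^2\big(1+O(\tfrac dn)\big)$; 2. $d_{\mathsf{KS}}(\mathcal{L}(L),\mathcal{N}(0,1))\le C\sqrt[4]{\tfrac dn}$. Here $C$ depends only on $\delta$, and the bound $O(\frac dn)$ holds uniformly over all $s\in(\delta,1-\delta)$.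
   Context: $\mathcal{L}(L)$ is the law of $L$ and $d_{\mathsf{KS}}(\mu,\nu)=\sup_{x_0\in\mathbb{R}}|\mu((-\infty,x_0])-\nu((-\infty,x_0])|$ is the Kolmogorov-Smirnov distance. Graphs are simple. Asymptotic statements are as $n\to\infty$. *)

(* Defs.v *)
From HB Require Import structures.
From mathcomp Require Export all_boot all_order all_algebra.
From mathcomp Require Export finmap.
From mathcomp Require Export all_classical all_reals all_analysis.
From mathcomp Require Import measurable_realfun.

Set Implicit Arguments.
Unset Strict Implicit.
Unset Printing Implicit Defensive.
Import Order.TTheory GRing.Theory Num.Theory.
Import numFieldNormedType.Exports.

Local Open Scope classical_set_scope.
Local Open Scope ring_scope.

Definition simple_graph (n : nat) (e : rel 'I_n) : Prop :=
  symmetric e /\ irreflexive e.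

Definition regular_graph (n d : nat) (e : rel 'I_n) : Prop :=
  simple_graph e /\ forall i : 'I_n, #|[set j : 'I_n | e i j]%SET| = d.

Definition adjacency_matrix (R : realType) (n : nat) (e : rel 'I_n) : 'M[R]_n :=
  \matrix_(i, j) (e i j)%:R.

Definition slice (R : realType) (n : nat) (s : R) : set 'cV[R]_n :=
  [set x | (forall i, x i 0 = -1 \/ x i 0 = 1) /\
           #|[set i : 'I_n | x i 0 == 1]%SET|%:R = s * n%:R].
Arguments slice {R} n s.

Section random_vector.
Context d (T : measurableType d) (R : realType) (n : nat).
Implicit Type X : 'I_n -> {mfun T >-> R}.

Definition random_vector X (t : T) : 'cV[R]_n := \col_i X i t.

(* Meant for a nonempty finite set S of vectors: the point masses then add up
   to 1, so X lies in S almost surely. *)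
Definition uniform_on (P : probability T R) (S : set 'cV[R]_n) X : Prop :=
  forall x, S x ->
    P [set t | random_vector X t = x] = (#|` fset_set S|%:R^-1)%:E.

Definition quadratic_form (A : 'M[R]_n) X (t : T) : R :=
  2^-1 * ((random_vector X t)^T *m A *m random_vector X t) 0 0.

Lemma measurable_quadratic_form (A : 'M[R]_n) X :
  measurable_fun setT (quadratic_form A X).
Proof.
have -> : quadratic_form A X =
    (fun t => 2^-1 * \sum_(j < n) (\sum_(i < n) X i t * A i j) * X j t).
  apply/funext => t; rewrite /quadratic_form mxE; congr (_ * _).
  apply: eq_bigr => j _; rewrite !mxE; congr (_ * _).
  by apply: eq_bigr => i _; rewrite !mxE.
apply: measurable_funM; first exact: measurable_cst.
apply: measurable_sum => j; apply: measurable_funM => //.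
by apply: measurable_sum => i; apply: measurable_funM.
Qed.

HB.instance Definition _ (A : 'M[R]_n) X :=
  isMeasurableFun.Build _ _ T R (quadratic_form A X)
    (measurable_quadratic_form A X).

End random_vector.

Section standardize.
Context d (T : measurableType d) (R : realType) (P : probability T R).
Implicit Type Y : {RV P >-> R}.

(* If Y has variance 0, division by zero makes this the constant 0. *)
Definition standardize Y (t : T) : R :=
  (Y t - fine 'E_P[Y]) / Num.sqrt (fine 'V_P[Y]).

Lemma measurable_standardize Y : measurable_fun setT (standardize Y).
Proof. by apply: measurable_funM => //; apply: measurable_funB. Qed.

HB.instance Definition _ Y :=
  isMeasurableFun.Build _ _ T R (standardize Y) (measurable_standardize Y).

End standardize.
Arguments standardize {d T R} P Y _.

(* On set functions rather than on probability R R, because the library puts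
   normal_prob on measurableTypeR R and distribution P L on R itself. *)
Definition dKS (R : realType) (mu nu : set R -> \bar R) : R :=
  sup (range (fun x0 : R => `|fine (mu [set x | x <= x0]) - fine (nu [set x | x <= x0])|)).

(* Main.v *)
Require Import Defs.
From HB Require Import structures.
From mathcomp Require Import all_boot all_order all_algebra all_fingroup.
From mathcomp Require Import all_classical all_reals all_analysis.
From mathcomp Require Import measurable_realfun.
From mathcomp Require Import lra ring.

Set Implicit Arguments.
Unset Strict Implicit.
Unset Printing Implicit Defensive.
Import Order.TTheory GRing.Theory Num.Theory.
Import numFieldNormedType.Exports.

(** Write X = y + m with m = 2 s - 1. On the slice the entries of y sum to 0,
    so regularity of the graph removes the linear part of X^T A X and leaves
    q = 1/2 y^T A y up to a constant. Averaging over the slice is averaging over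
    the rearrangements of one of its points by p in S_n ([slice_mean]), and on
    functions of p acts the Laplacian of the random transposition walk. The proof
    rests on the fact that the centred form is an eigenfunction of it
    ([sum_graph_form_swapped]): the sum over (i, j) of the increments of q under
    the exchange of y_i and y_j is - 4 (n - 1) (q - E q).

    Variance. Summation by parts against the Laplacian gives
    E Gamma = 8 (n - 1) var q, where Gamma is the sum over (i, j) of the squared
    increments. Gamma is an explicit polynomial ([sum_sqr_graph_form_swapped]),
    affine in q^2 and otherwise involving only mixed moments of order at most
    three, so the identity is a linear equation for var q ([form_variance_eq]).

    Normal approximation. For an eigenfunction W of variance 1, the same summation
    by parts turns E (f'(W) - W f(W)) into the fluctuation of Gamma around its mean
    plus a Taylor remainder controlled by the largest increment of W
    ([stein_eigenfunction]). An increment of q is O(d), while the standard deviation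
    has order sqrt (n d), which makes the remainder O(sqrt (d / n)) times the
    Lipschitz constant of f'. The fluctuation of Gamma is bounded with the spectral
    gap of the walk ([poincare_perm]): E (Gamma - E Gamma)^2 is at most 1/n times
    the energy of Gamma, and comes out O((n d)^3), whereas E Gamma has order n^2 d.

    The functions f are the solutions of Stein's equation for piecewise linear
    approximations of half-line indicators, of slope 1/e ([ramp_stein_solution]):
    f' is bounded, with Lipschitz constant O(1/e). The error e^2 (1 + 1/e) with
    e^4 = d / n, together with the error O(e) of replacing the indicators, is the
    claimed O(e). *)

Local Open Scope ring_scope.


(** * Spectral gap of the random transposition walk *)

Section Poincare.
Context (R : realFieldType) (n : nat).
Implicit Types (F G : 'S_n -> R) (g h p : 'S_n) (i j k l : 'I_n).

Definition swap_diff F i j p : R := F (tperm i j * p)%g - F p.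

Definition autocorr F g : R := \sum_p F p * F (g * p)%g.

Lemma sum_shift F g : \sum_p F (g * p)%g = \sum_p F p.
Proof. by rewrite [RHS](reindex_inj (mulgI g)). Qed.

Lemma autocorrE F g h :
  \sum_p F (g * p)%g * F (h * p)%g = autocorr F (h * g^-1)%g.
Proof.
rewrite /autocorr [RHS](reindex_inj (mulgI g)) /=.
by apply: eq_bigr => p _; rewrite -mulgA mulKg.
Qed.

Lemma autocorrV F g : autocorr F g^-1 = autocorr F g.
Proof.
rewrite -[in LHS](mul1g g^-1%g) -autocorrE.
by apply: eq_bigr => p _; rewrite mul1g mulrC.
Qed.

Definition swap_corr F i j k l : R :=
  \sum_p swap_diff F i j p * swap_diff F k l p.

Lemma swap_corr_autocorr F i j k l : swap_corr F i j k l =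
  autocorr F (tperm k l * tperm i j)%g - autocorr F (tperm i j)
  - autocorr F (tperm k l) + autocorr F 1%g.
Proof.
have := autocorrE F (tperm i j) (tperm k l); rewrite tpermV => <-.
rewrite /swap_corr /autocorr -!sumrB -big_split /=; apply: eq_bigr => p _.
by rewrite /swap_diff mul1g; ring.
Qed.

Lemma swap_corrC F i j k l : swap_corr F i j k l = swap_corr F k l i j.
Proof. by apply: eq_bigr => p _; rewrite mulrC. Qed.

Lemma swap_corr_tpermC F i j k l : swap_corr F j i k l = swap_corr F i j k l.
Proof. by rewrite /swap_corr /swap_diff tpermC. Qed.

Lemma swap_corr0 F i k l : swap_corr F i i k l = 0.
Proof.
rewrite /swap_corr big1 // => p _.
by rewrite /swap_diff tperm1 mul1g subrr mul0r.
Qed.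

Lemma swap_corr_ge0 F i j : 0 <= swap_corr F i j i j.
Proof. by apply: sumr_ge0 => p _; rewrite -expr2 sqr_ge0. Qed.

Lemma swap_corr_diag F i j :
  swap_corr F i j i j = 2 * (autocorr F 1%g - autocorr F (tperm i j)).
Proof. by rewrite swap_corr_autocorr tperm2; ring. Qed.

Lemma tperm_disjointC i j k l : [&& k != i, k != j, l != i & l != j] ->
  commute (tperm i j) (tperm k l).
Proof.
case/and4P => ki kj li lj.
by rewrite /commute conjgC tpermJ !(tpermD ki li, tpermD kj lj).
Qed.

(** Commuting involutions s and t satisfy
    (1 - s) (1 - t) = 1/4 ((1 - s) (1 - t))^2, and the left-hand side is a
    self-adjoint operator. *)
Lemma swap_corr_disjoint F i j k l : [&& k != i, k != j, l != i & l != j] ->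
  0 <= swap_corr F i j k l.
Proof.
move=> /tperm_disjointC com; set s := tperm i j in com *.
set t := tperm k l in com *.
have -> : swap_corr F i j k l = 4^-1 *
   \sum_p (F (1 * p)%g - F (s * p)%g - F (t * p)%g + F (t * s * p)%g) ^+ 2.
  rewrite swap_corr_autocorr -/s -/t.
  have E a b c e : (a - b - c + e) ^+ 2 =
    a * a + b * b + c * c + e * e - 2 * (a * b) - 2 * (a * c) + 2 * (a * e)
    + 2 * (b * c) - 2 * (b * e) - 2 * (c * e) :> R by ring.
  under eq_bigr do rewrite E.
  rewrite !(big_split, sumrB, sumrN) /= -!mulr_sumr !autocorrE.
  rewrite !mulgV !invg1 !mulg1 !tpermV -!mulgA !tperm2 mulg1.
  by rewrite [(t * (s * t))%g]mulgA -com -mulgA tperm2 mulg1; field.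
by rewrite mulr_ge0 ?invr_ge0 // sumr_ge0 // => p _; rewrite sqr_ge0.
Qed.


(** The square of the alternating sum of [F] over the six elements of the
    copy of S_3 acting on {i, j, k} is nonnegative; written out, this is the
    inequality between the correlations of the three transpositions when
    i, j and k are distinct. *)
Lemma swap_corr_triple F i j k :
  2^-1 * (2^-1 * swap_corr F i j i j + 2^-1 * swap_corr F j k j k
          + 2^-1 * swap_corr F i k i k)
  <= swap_corr F i j i k + swap_corr F j i j k + swap_corr F k i k j.
Proof.
have flip a b : swap_corr F a b a b = swap_corr F b a b a.
  by rewrite /swap_corr /swap_diff tpermC.
have [->|ij] := eqVneq i j.
  by rewrite !swap_corr0 (flip k j); have := swap_corr_ge0 F j k; lra.
have [->|ik] := eqVneq i k.
  rewrite (swap_corrC F k j k k) !swap_corr0 (flip k j).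
  by have := swap_corr_ge0 F j k; lra.
have [->|jk] := eqVneq j k.
  rewrite (swap_corrC F k i k k) !swap_corr0 .
  by have := swap_corr_ge0 F i k; lra.
rewrite !swap_corr_diag !swap_corr_autocorr.
rewrite (tpermC j i) (tpermC k i) (tpermC k j).
set s := tperm i j; set t := tperm i k; set u := tperm j k.
have ss : (s * s = 1)%g by rewrite tperm2.
have tt : (t * t = 1)%g by rewrite tperm2.
have uu : (u * u = 1)%g by rewrite tperm2.
have us : (u * s = s * t)%g by rewrite conjgC tpermJ tpermR tpermD.
have ut : (u * t = t * s)%g.
  by rewrite conjgC tpermJ tpermR (tpermD ij) 1?eq_sym // (tpermC j i).
have sts : (s * (t * s) = u)%g by rewrite mulgA -us -mulgA ss mulg1.
have tst : (t * (s * t) = u)%g by rewrite mulgA -ut -mulgA tt mulg1.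
have ac : autocorr F (t * s)%g = autocorr F (s * t)%g.
  by rewrite -[LHS]autocorrV invMg !tpermV.
have: 0 <= \sum_p (F (1 * p)%g + F (s * t * p)%g + F (t * s * p)%g
                    - F (s * p)%g - F (t * p)%g - F (u * p)%g) ^+ 2.
  by apply: sumr_ge0 => p _; exact: sqr_ge0.
have E a b c d e f : (a + b + c - d - e - f) ^+ 2 =
    a * a + b * b + c * c + d * d + e * e + f * f
    + 2 * (a * b) + 2 * (a * c) + 2 * (b * c)
    + 2 * (d * e) + 2 * (d * f) + 2 * (e * f)
    - 2 * (a * d) - 2 * (a * e) - 2 * (a * f)
    - 2 * (b * d) - 2 * (b * e) - 2 * (b * f)
    - 2 * (c * d) - 2 * (c * e) - 2 * (c * f) :> R by ring.
under eq_bigr do rewrite E.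
rewrite !(big_split, sumrB, sumrN) /= -!mulr_sumr !autocorrE.
rewrite !invMg !invg1 !tpermV -/s -/t -/u !mulg1 ss tt uu.
have -> : (s * t * (t * s) = 1)%g by rewrite -mulgA (mulgA t) tt mul1g.
have -> : (t * s * (s * t) = 1)%g by rewrite -mulgA (mulgA s) ss mul1g.
have tu : (t * u = s * t)%g.
  by rewrite -[LHS]invgK invMg !tpermV -/t -/u ut invMg !tpermV.
have -> : (t * s * (t * s) = s * t)%g by rewrite -mulgA sts.
rewrite us ut.
have -> : (s * (t * s) = u)%g by [].
have -> : (t * (t * s) = s)%g by rewrite mulgA tt mul1g.
have -> : (u * (t * s) = t)%g by rewrite mulgA ut -mulgA ss mulg1.
have -> : (s * (s * t) = t)%g by rewrite mulgA ss mul1g.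
have -> : (t * (s * t) = u)%g by [].
have -> : (u * (s * t) = s)%g by rewrite mulgA us -mulgA tt mulg1.
rewrite ac; lra.
Qed.


Definition swap_energy F : R := \sum_i \sum_j swap_corr F i j i j.

Definition swap_laplacian F p : R := \sum_i \sum_j swap_diff F i j p.

Lemma sum_eq_mul (g : 'I_n -> R) i : \sum_k (k == i)%:R * g k = g i.
Proof.
rewrite (bigD1 i) //= eqxx mul1r big1 ?addr0 // => k /negbTE ->.
by rewrite mul0r.
Qed.

(** The pairs (k, l) disjoint from {i, j} contribute nonnegatively; the others
    are counted by inclusion and exclusion on whether k or l meets {i, j}. *)
Lemma swap_corr_row_ge F i j :
  2 * \sum_l (swap_corr F i j i l + swap_corr F i j j l)
    - 2 * swap_corr F i j i j <= \sum_k \sum_l swap_corr F i j k l.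
Proof.
have [->|ij] := eqVneq i j.
  rewrite swap_corr0 big1 => [|l _]; last by rewrite !swap_corr0 addr0.
  rewrite big1 ?mulr0 ?subr0 // => k _; rewrite big1 // => l _.
  by rewrite swap_corr0.
(* The indicator of {i, j}; 1 - (1 - c k) (1 - c l) is that of overlap. *)
pose c k : R := (k == i)%:R + (k == j)%:R.
have sum_c (g : 'I_n -> R) : \sum_k c k * g k = g i + g j.
  by under eq_bigr do rewrite mulrDl; rewrite big_split /= !sum_eq_mul.
have le k l : (c k + c l - c k * c l) * swap_corr F i j k l
              <= swap_corr F i j k l.
  have [/andP[/norP[ki kj] /norP[li lj]]|] :=
      boolP (~~ ((k == i) || (k == j)) && ~~ ((l == i) || (l == j))).
    rewrite /c (negbTE ki) (negbTE kj) (negbTE li) (negbTE lj).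
    rewrite !addr0 mulr0 subr0 mul0r swap_corr_disjoint //.
    by rewrite ki kj li.
  have c1 m : (m == i) || (m == j) -> c m = 1.
    rewrite /c; case: (eqVneq m i) => [->|_] /=; last by move->; rewrite add0r.
    by rewrite (negbTE ij) addr0.
  rewrite negb_and !negbK => /orP[/c1 ->|/c1 ->]; rewrite ?mul1r ?mulr1.
    by rewrite addrK mul1r.
  by rewrite addrAC subrr add0r mul1r.
apply: le_trans (ler_sum _ (fun k _ => ler_sum _ (fun l _ => le k l))).
rewrite le_eqVlt; apply/orP; left; apply/eqP/esym.
under eq_bigr => k _.
  under eq_bigr => l _ do rewrite mulrBl mulrDl -mulrA.
  rewrite sumrB big_split /= -!mulr_sumr !sum_c.
  over.
rewrite sumrB big_split /= !sum_c big_split /=.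
have flip k l : swap_corr F i j k l = swap_corr F i j l k.
  by rewrite swap_corrC swap_corr_tpermC swap_corrC.
have z k : swap_corr F i j k k = 0 by rewrite swap_corrC swap_corr0.
rewrite !z (flip j i) big_split /=.
under [X in _ + (X + _) - _]eq_bigr do rewrite flip.
under [X in _ + (_ + X) - _]eq_bigr do rewrite flip.
ring.
Qed.

(** The curvature bound L^2 >= 2 (n - 2) (- L) for the Laplacian L, whose energy
    is - 2 <F, L F>: expanding |L F|^2 over pairs of transpositions, disjoint ones
    contribute nonnegatively and overlapping ones are grouped into triangles.
    The constant 2 (n - 2) falls short of the true gap 2 n, because coinciding
    indices in the triangles are estimated crudely. *)
Lemma swap_energy_le_laplacian F :
  (n%:R - 2) * swap_energy F <= \sum_p swap_laplacian F p ^+ 2.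
Proof.
have -> : \sum_p swap_laplacian F p ^+ 2 =
    \sum_i \sum_j \sum_k \sum_l swap_corr F i j k l.
  under eq_bigr => p _.
    rewrite expr2 mulr_suml.
    under eq_bigr => i _.
      rewrite mulr_suml.
      under eq_bigr => j _.
        rewrite mulr_sumr; under eq_bigr => k _ do rewrite mulr_sumr.
        over.
      over.
    over.
  rewrite exchange_big; apply: eq_bigr => i _.
  rewrite exchange_big; apply: eq_bigr => j _.
  rewrite exchange_big; apply: eq_bigr => k _.
  by rewrite exchange_big.
apply: le_trans (ler_sum _ (fun i _ => ler_sum _ (fun j _ =>
  swap_corr_row_ge F i j))).
pose U := \sum_i \sum_j \sum_l swap_corr F i j i l.
have EU : \sum_i \sum_j \sum_l swap_corr F i j j l = U.
  rewrite exchange_big; apply: eq_bigr => i _; apply: eq_bigr => j _.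
  by apply: eq_bigr => l _; rewrite swap_corr_tpermC.
have -> : \sum_i \sum_j (2 * \sum_l (swap_corr F i j i l + swap_corr F i j j l)
      - 2 * swap_corr F i j i j) = 4 * U - 2 * swap_energy F.
  under eq_bigr => i _.
    under eq_bigr => j _ do rewrite big_split.
    rewrite sumrB -!mulr_sumr big_split /=; over.
  rewrite sumrB -!mulr_sumr big_split /= EU -/U -/(swap_energy F); ring.
have: n%:R * swap_energy F <= 4 * U; last by lra.
have T : \sum_i \sum_j \sum_k
    (swap_corr F i j i k + swap_corr F j i j k + swap_corr F k i k j) = 3 * U.
  under eq_bigr => i _.
    under eq_bigr => j _ do rewrite !big_split.
    rewrite !big_split; over.
  rewrite !big_split /= -/U.
  have -> : \sum_i \sum_j \sum_k swap_corr F j i j k = U.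
    by rewrite exchange_big.
  have -> : \sum_i \sum_j \sum_k swap_corr F k i k j = U.
    under eq_bigr do rewrite exchange_big /=.
    by rewrite exchange_big.
  ring.
have := ler_sum _ (fun i _ => ler_sum _ (fun j _ => ler_sum _ (fun k _ =>
  swap_corr_triple F i j k))).
move=> /(_ (index_enum _) xpredT (index_enum _) xpredT (index_enum _) xpredT).
rewrite T.
have -> : \sum_i \sum_j \sum_k
   (2^-1 * (2^-1 * swap_corr F i j i j + 2^-1 * swap_corr F j k j k
          + 2^-1 * swap_corr F i k i k)) = 3 / 4 * (n%:R * swap_energy F).
  have c (x : R) : \sum_(i < n) x = n%:R * x.
    by rewrite sumr_const card_ord mulr_natl.
  under eq_bigr => i _.
    under eq_bigr => j _ do rewrite -mulr_sumr !big_split /= -!mulr_sumr c.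
    rewrite -mulr_sumr !big_split /= -!mulr_sumr; over.
  rewrite -mulr_sumr !big_split /= -!mulr_sumr.
  rewrite !c; under [X in _ + _ * X]eq_bigr do rewrite c.
  by rewrite -mulr_sumr -/(swap_energy F); field.
lra.
Qed.

Lemma sum_swap_diffM F G i j :
  \sum_p F p * swap_diff G i j p
  = - 2^-1 * \sum_p swap_diff F i j p * swap_diff G i j p.
Proof.
set s := tperm i j.
have : \sum_p F (s * p)%g * swap_diff G i j p
     = - \sum_p F p * swap_diff G i j p.
  rewrite [LHS](reindex_inj (mulgI s)) -sumrN; apply: eq_bigr => p _.
  by rewrite /swap_diff -/s mulgA tperm2 mul1g; ring.
rewrite [X in _ = _ * X](_ : _ = \sum_p F (s * p)%g * swap_diff G i j p
   - \sum_p F p * swap_diff G i j p).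
  by move=> ->; field.
by rewrite -sumrB; apply: eq_bigr => p _; rewrite -mulrBl.
Qed.

(** Summation by parts: each transposition is a self-adjoint involution. *)
Lemma sum_laplacianM F G :
  \sum_p F p * swap_laplacian G p
  = - 2^-1 * \sum_i \sum_j \sum_p swap_diff F i j p * swap_diff G i j p.
Proof.
under eq_bigr => p _.
  rewrite mulr_sumr; under eq_bigr => i _ do rewrite mulr_sumr; over.
rewrite exchange_big mulr_sumr; apply: eq_bigr => i _ /=.
rewrite exchange_big mulr_sumr; apply: eq_bigr => j _ /=.
exact: sum_swap_diffM.
Qed.

Lemma laplacian_eq0_const F : (forall p, swap_laplacian F p = 0) ->
  forall p, F p = F 1%g.
Proof.
move=> F0; have E0 : swap_energy F = 0.
  have := sum_laplacianM F F; rewrite big1 => [|p _]; last by rewrite F0 mulr0.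
  by move/esym/eqP; rewrite mulf_eq0 oppr_eq0 invr_eq0 pnatr_eq0 => /eqP.
have D0 i j p : F (tperm i j * p)%g = F p.
  apply/eqP; rewrite -subr_eq0; apply/eqP.
  have /eqP := E0; rewrite psumr_eq0 => [|k _]; last first.
    by apply: sumr_ge0 => l _; exact: swap_corr_ge0.
  move=> /allP/(_ i); rewrite mem_index_enum => /(_ isT) /=.
  rewrite psumr_eq0 => [|k _]; last exact: swap_corr_ge0.
  move=> /allP/(_ j); rewrite mem_index_enum => /(_ isT) /=.
  rewrite psumr_eq0 => [|q _]; last by rewrite -expr2 sqr_ge0.
  move=> /allP/(_ p); rewrite mem_index_enum => /(_ isT) /=.
  by rewrite mulf_eq0 orbb => /eqP.
move=> p; case: (prod_tpermP p) => ts -> _.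
elim: ts => [|[i j] ts IH]; first by rewrite big_nil.
by rewrite big_cons D0.
Qed.

(** The Laplacian is symmetric with the constants as kernel, so its image is
    the space of functions of mean zero. *)
Lemma laplacian_surj F : \sum_p F p = 0 ->
  exists G, forall p, F p = swap_laplacian G p.
Proof.
move=> F0.
pose lap (v : 'rV[R]_#|'S_n|) : 'rV[R]_#|'S_n| := \row_a swap_laplacian
  (fun p => v 0 (enum_rank p)) (enum_val a : 'S_n).
pose M : 'M[R]_#|'S_n| := \matrix_(a, b) swap_laplacian (fun p => (p == enum_val a)%:R)
  (enum_val b : 'S_n).
have lapM (v : 'rV[R]_#|'S_n|) : v *m M = lap v.
  apply/rowP => b; rewrite !mxE.
  have E p : v 0 (enum_rank p) = \sum_a v 0 a * (p == enum_val a :> 'S_n)%:R.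
    rewrite (bigD1 (enum_rank p)) //= enum_rankK eqxx mulr1 big1 ?addr0 //.
    move=> a ap; case: eqP => [pa|_]; last by rewrite mulr0.
    by rewrite pa enum_valK eqxx in ap.
  rewrite /swap_laplacian /swap_diff.
  under [RHS]eq_bigr => i _ do under eq_bigr => j _ do rewrite !E -sumrB.
  under [LHS]eq_bigr => a _.
    rewrite mxE mulr_sumr; under eq_bigr => i _ do rewrite mulr_sumr; over.
  rewrite exchange_big; apply: eq_bigr => i _ /=.
  rewrite exchange_big; apply: eq_bigr => j _ /=.
  by apply: eq_bigr => a _; rewrite mulrBr.
have Msym : M^T = M.
  apply/matrixP => a b; rewrite !mxE.
  pose d (a : 'I_#|'S_n|) p : R := (p == enum_val a :> 'S_n)%:R.
  have dE c G : \sum_p d c p * G p = G (enum_val c).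
    rewrite (bigD1 (enum_val c)) //= /d eqxx mul1r big1 ?addr0 // => p.
    by move/negbTE->; rewrite mul0r.
  rewrite -[LHS]dE -[RHS]dE !sum_laplacianM; congr (_ * _).
  apply: eq_bigr => i _; apply: eq_bigr => j _; apply: eq_bigr => p _.
  by rewrite mulrC.
pose f : 'rV[R]_#|'S_n| := \row_a F (enum_val a : 'S_n).
have : (f <= M)%MS.
  rewrite submxE; apply/eqP/rowP => c; rewrite !mxE.
  pose v := row c (cokermx M)^T.
  have : lap v = 0.
    by rewrite -lapM /v -{2}Msym -row_mul -trmx_mul mulmx_coker trmx0 row0.
  move=> lv.
  have vc p : v 0 (enum_rank p) = v 0 (enum_rank (1%g : 'S_n)).
    apply: (laplacian_eq0_const (F := fun p => v 0 (enum_rank p))) => q.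
    by have := congr1 (fun w : 'rV_ _ => w 0 (enum_rank q)) lv;
      rewrite !mxE enum_rankK.
  under eq_bigr => a _.
    rewrite (_ : cokermx M a c = v 0 (enum_rank (1%g : 'S_n))); last first.
      by rewrite -(vc (enum_val a)) enum_valK !mxE.
    rewrite mxE; over.
  rewrite -mulr_suml (_ : \sum_a _ = 0) ?mul0r //.
  rewrite -[RHS]F0 [RHS](reindex (fun a : 'I_#|'S_n| => enum_val a : 'S_n)) //=.
  by apply: onW_bij; exact: enum_val_bij.
case/submxP => g fg; exists (fun p => g 0 (enum_rank p)) => p.
have := congr1 (fun w : 'rV_ _ => w 0 (enum_rank p)) fg.
by rewrite lapM !mxE enum_rankK.
Qed.

(** Duality turns the curvature bound into a spectral gap: if F = L G then
    |F|^2 = <F, L G> is controlled by the energies of F and of G, and the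
    latter is at most |F|^2 / (n - 2). *)
Lemma poincare_perm F : (2 < n)%N -> \sum_p F p = 0 ->
  4 * (n%:R - 2) * \sum_p F p ^+ 2 <= swap_energy F.
Proof.
move=> n2 /laplacian_surj[G FG].
have n0 : 0 < n%:R - 2 :> R by rewrite subr_gt0 (ltr_nat R 2 n).
have := swap_energy_le_laplacian G.
under eq_bigr do rewrite -FG.
set S := \sum_p _ => EG.
have : S = - 2^-1 * \sum_i \sum_j \sum_p swap_diff F i j p * swap_diff G i j p.
  by rewrite -sum_laplacianM; apply: eq_bigr => p _; rewrite expr2 {2}FG.
have : 0 <= \sum_i \sum_j \sum_p
    (swap_diff F i j p + 2 * (n%:R - 2) * swap_diff G i j p) ^+ 2.
  by do 3![apply: sumr_ge0 => ? _]; exact: sqr_ge0.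
have -> : \sum_i \sum_j \sum_p
    (swap_diff F i j p + 2 * (n%:R - 2) * swap_diff G i j p) ^+ 2 =
  swap_energy F + 4 * (n%:R - 2) ^+ 2 * swap_energy G
  + 4 * (n%:R - 2) * \sum_i \sum_j \sum_p swap_diff F i j p * swap_diff G i j p.
  rewrite /swap_energy !mulr_sumr -!big_split; apply: eq_bigr => i _ /=.
  rewrite !mulr_sumr -!big_split; apply: eq_bigr => j _ /=.
  rewrite !mulr_sumr -!big_split; apply: eq_bigr => p _ /=.
  ring.
nra.
Qed.

End Poincare.


(** * Effect of an exchange of two entries on the quadratic form *)

Section quadratic_swap.
Context (R : realFieldType) (n : nat) (a : 'I_n -> 'I_n -> R).
Implicit Types (y : 'I_n -> R) (i j k v : 'I_n).

Definition nbr_sum y v : R := \sum_k a v k * y k.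

Definition graph_form y : R := 2^-1 * \sum_v y v * nbr_sum y v.

Definition swapped y i j : 'I_n -> R := fun v => y (tperm i j v).

Lemma swappedE y i j v :
  swapped y i j v = y v + ((v == i)%:R - (v == j)%:R) * (y j - y i).
Proof.
rewrite /swapped; case: tpermP => [->|->|/eqP/negbTE -> /eqP/negbTE ->].
- by rewrite eqxx; have [->|_] := eqVneq i j => /=; ring.
- by rewrite eqxx; have [->|_] := eqVneq j i => /=; ring.
- by ring.
Qed.

Lemma nbr_sum_swapped y i j v :
  nbr_sum (swapped y i j) v = nbr_sum y v + (a v i - a v j) * (y j - y i).
Proof.
rewrite /nbr_sum -(sum_eq_mul (a v) i) -(sum_eq_mul (a v) j).
rewrite -sumrB mulr_suml -big_split; apply: eq_bigr => k _ /=.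
by rewrite swappedE; ring.
Qed.

Context (D : R).
Context (asym : forall i j, a i j = a j i) (adiag : forall i, a i i = 0)
  (a_idem : forall i j, a i j * a i j = a i j)
  (adeg : forall i, \sum_j a i j = D).

Lemma sum_nbr_sumM y v : \sum_k y k * a k v = nbr_sum y v.
Proof. by apply: eq_bigr => k _; rewrite asym mulrC. Qed.

Lemma graph_form_swapped y i j :
  graph_form (swapped y i j) - graph_form y =
  (y j - y i) * (nbr_sum y i - nbr_sum y j) - a i j * (y j - y i) ^+ 2.
Proof.
rewrite /graph_form -mulrBr.
under eq_bigr do rewrite nbr_sum_swapped swappedE.
rewrite -sumrB; set t := y j - y i.
transitivity (2^-1 * (t * (\sum_v (v == i)%:R * nbr_sum y v
    - \sum_v (v == j)%:R * nbr_sum y v)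
  + t * (\sum_v y v * a v i - \sum_v y v * a v j)
  + t ^+ 2 * (\sum_v (v == i)%:R * a v i - \sum_v (v == i)%:R * a v j
    - \sum_v (v == j)%:R * a v i + \sum_v (v == j)%:R * a v j))).
  congr (_ * _); rewrite -!sumrB -!big_split !mulr_sumr -!big_split.
  by apply: eq_bigr => v _ /=; ring.
by rewrite !sum_eq_mul !sum_nbr_sumM !adiag (asym j i); field.
Qed.

Lemma sum_nbr_sum y : \sum_v nbr_sum y v = D * \sum_v y v.
Proof.
rewrite exchange_big mulr_sumr; apply: eq_bigr => k _ /=.
by rewrite -mulr_suml -(adeg k); congr (_ * _); apply: eq_bigr => v _.
Qed.

Lemma sum_form y : \sum_v y v * nbr_sum y v = 2 * graph_form y.
Proof. by rewrite /graph_form; field. Qed.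

Lemma sum_sum_const (f g : 'I_n -> R) :
  \sum_i \sum_j f i * g j = (\sum_i f i) * (\sum_j g j).
Proof. by rewrite mulr_suml; apply: eq_bigr => i _; rewrite mulr_sumr. Qed.

Lemma sum_sum_left (f : 'I_n -> R) : \sum_i \sum_(j < n) f i = n%:R * \sum_i f i.
Proof.
by rewrite mulr_sumr; apply: eq_bigr => i _; rewrite sumr_const card_ord mulr_natl.
Qed.

Lemma sum_sum_right (f : 'I_n -> R) : \sum_(i < n) \sum_j f j = n%:R * \sum_i f i.
Proof. by rewrite exchange_big sum_sum_left. Qed.

Lemma sum_adj_left (f : 'I_n -> R) : \sum_i \sum_j a i j * f i = D * \sum_i f i.
Proof.
by rewrite mulr_sumr; apply: eq_bigr => i _; rewrite -mulr_suml adeg.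
Qed.

Lemma sum_adj_right (f : 'I_n -> R) : \sum_i \sum_j a i j * f j = D * \sum_i f i.
Proof.
by rewrite exchange_big -sum_adj_left; apply: eq_bigr => i _;
  apply: eq_bigr => j _; rewrite asym.
Qed.

Lemma sum_adj_both y (f : 'I_n -> R) :
  \sum_i \sum_j a i j * (f i * y j) = \sum_i f i * nbr_sum y i.
Proof.
by apply: eq_bigr => i _; rewrite mulr_sumr; apply: eq_bigr => j _; rewrite mulrCA.
Qed.

Lemma sum_adj_bothC y (f : 'I_n -> R) :
  \sum_i \sum_j a i j * (y i * f j) = \sum_i f i * nbr_sum y i.
Proof.
rewrite exchange_big -sum_adj_both; apply: eq_bigr => i _.
by apply: eq_bigr => j _; rewrite asym (mulrC (y j)).
Qed.

Context (m : R) (y : 'I_n -> R).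
Context (ysum : \sum_v y v = 0) (ysq : forall v, (y v + m) ^+ 2 = 1).
Let rho := 1 - m ^+ 2.
Let N := nbr_sum y.

Lemma sqr_centered v : y v ^+ 2 = rho - 2 * m * y v.
Proof. by have := ysq v; rewrite /rho sqrrD; lra. Qed.

Lemma sum_sqr_centered : \sum_v y v ^+ 2 = n%:R * rho.
Proof.
under eq_bigr do rewrite sqr_centered.
rewrite sumrB -mulr_sumr ysum mulr0 subr0.
by rewrite sumr_const card_ord mulr_natl.
Qed.

Let Nsum : \sum_v N v = 0.
Proof. by rewrite /N sum_nbr_sum ysum mulr0. Qed.

(** The form is, up to an additive constant, an eigenfunction of the random
    transposition Laplacian: linear terms vanish because y has sum zero, and by
    regularity the squares y_v^2 all enter with the same weight. *)
Lemma sum_graph_form_swapped :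
  \sum_i \sum_j (graph_form (swapped y i j) - graph_form y) =
  - 4 * (n%:R - 1) * graph_form y - 2 * D * n%:R * rho.
Proof.
have [M EM] : exists M, M = nbr_sum y by exists (nbr_sum y).
transitivity (
  (\sum_i \sum_j M i * y j) + (\sum_i \sum_j y i * M j)
  + (- 1) * (\sum_i \sum_(j < n) y i * M i)
  + (- 1) * (\sum_(i < n) \sum_j y j * M j)
  + (- 1) * (\sum_i \sum_j a i j * y i ^+ 2)
  + (- 1) * (\sum_i \sum_j a i j * y j ^+ 2)
  + 2 * \sum_i \sum_j a i j * (y i * y j)).
  rewrite !mulr_sumr -!big_split; apply: eq_bigr => i _ /=.
  rewrite !mulr_sumr -!big_split; apply: eq_bigr => j _ /=.
  by rewrite graph_form_swapped -EM; ring.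
rewrite EM -/N.
rewrite !sum_sum_const !sum_sum_left !sum_sum_right !sum_adj_left !sum_adj_right.
by rewrite sum_adj_both sum_form ysum mulr0 mul0r sum_sqr_centered; ring.
Qed.

(** The entries of y + m are signs, so an increment t = y_j - y_i satisfies
    t^3 = 4 t and t^4 = 4 t^2, which keeps the degree low. The sums over pairs then
    factor, and many vanish because y and [nbr_sum a y] both have sum zero. *)
Lemma sum_sqr_graph_form_swapped :
  \sum_i \sum_j (graph_form (swapped y i j) - graph_form y) ^+ 2 =
  4 * \sum_v (n%:R * (rho - m * y v) - 4) * N v ^+ 2
  + 16 * graph_form y ^+ 2 + (32 * D - 16) * graph_form y + 8 * D * n%:R * rho.
Proof.
have cube i j : (y j - y i) ^+ 3 = 4 * (y j - y i).
  have ui := ysq i; have uj := ysq j.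
  have -> : y j - y i = (y j + m) - (y i + m) by ring.
  move: ui uj; set u := y i + m; set w := y j + m => ui uj.
  have -> : (w - u) ^+ 3 = w ^+ 2 * w - 3 * w ^+ 2 * u + 3 * u ^+ 2 * w - u ^+ 2 * u.
    by ring.
  by rewrite ui uj; ring.
have [M EM] : exists M, M = nbr_sum y by exists (nbr_sum y).
transitivity (
  (\sum_i \sum_(j < n) 2 * (rho - m * y i) * M i ^+ 2)
  + (\sum_(i < n) \sum_j 2 * (rho - m * y j) * M j ^+ 2)
  + (- 2 * m) * (\sum_i \sum_j y i * M j ^+ 2)
  + (- 2 * m) * (\sum_i \sum_j M i ^+ 2 * y j)
  + (- 2) * (\sum_i \sum_j y i * M i ^+ 2 * y j)
  + (- 2) * (\sum_i \sum_j y i * (y j * M j ^+ 2))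
  + (- 4 * rho) * (\sum_i \sum_j M i * M j)
  + (4 * m) * (\sum_i \sum_j y i * M i * M j)
  + (4 * m) * (\sum_i \sum_j M i * (y j * M j))
  + 4 * (\sum_i \sum_j y i * M i * (y j * M j))
  + (- 8) * (\sum_i \sum_j a i j * (M i * y j))
  + (- 8) * (\sum_i \sum_j a i j * (y i * M j))
  + 8 * (\sum_i \sum_j a i j * (y i * M i))
  + 8 * (\sum_i \sum_j a i j * (y j * M j))
  + 4 * (\sum_i \sum_j a i j * y i ^+ 2)
  + 4 * (\sum_i \sum_j a i j * y j ^+ 2)
  + (- 8) * (\sum_i \sum_j a i j * (y i * y j))).
  rewrite !mulr_sumr -!big_split; apply: eq_bigr => i _ /=.
  rewrite !mulr_sumr -!big_split; apply: eq_bigr => j _ /=.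
  rewrite graph_form_swapped -EM sqrrB.
  rewrite exprMn (exprMn _ (a i j)) (expr2 (a i j)) a_idem -exprM.
  rewrite (_ : (y j - y i) ^+ (2 * 2) = 4 * (y j - y i) ^+ 2); last first.
    by rewrite (exprS _ 3) cube; ring.
  rewrite [X in _ - X + _](_ : _ =
    2 * a i j * (y j - y i) ^+ 3 * (M i - M j)); last by rewrite -mulr_natl; ring.
  rewrite cube.
  rewrite [(y j - y i) ^+ 2 * _](_ : _ = (2 * rho - 2 * m * (y i + y j)
     - 2 * y i * y j) * (M i - M j) ^+ 2); last first.
    by congr (_ * _); rewrite sqrrB !sqr_centered -mulr_natl; ring.
  ring.
rewrite EM -/N.
rewrite !sum_sum_const !sum_sum_left !sum_sum_right !sum_adj_left !sum_adj_right.
rewrite (sum_adj_bothC y N) !(sum_adj_both y) !sum_form ysum ?Nsum sum_sqr_centered.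
rewrite -/N; clearbody N.
have -> : \sum_v (n%:R * (rho - m * y v) - 4) * N v ^+ 2 =
    n%:R * \sum_v (rho - m * y v) * N v ^+ 2 - 4 * \sum_v N v * N v.
  by rewrite !mulr_sumr -sumrB; apply: eq_bigr => v _; ring.
have -> : \sum_i 2 * (rho - m * y i) * N i ^+ 2 =
    2 * \sum_v (rho - m * y v) * N v ^+ 2.
  by rewrite mulr_sumr; apply: eq_bigr => v _; ring.
ring.
Qed.

End quadratic_swap.


(** * Averages over permutations and mixed moments *)

Section perm_mean.
Context (R : realFieldType) (n : nat).
Implicit Types (F G : 'S_n -> R) (y : 'I_n -> R) (H : ('I_n -> R) -> R).

Definition perm_mean F : R := (\sum_p F p) / n`!%:R.

Lemma eq_perm_mean F G : (forall p, F p = G p) -> perm_mean F = perm_mean G.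
Proof. by move=> FG; rewrite /perm_mean; under eq_bigr do rewrite FG. Qed.

Lemma perm_meanD F G :
  perm_mean (fun p => F p + G p) = perm_mean F + perm_mean G.
Proof. by rewrite /perm_mean big_split mulrDl. Qed.

Lemma perm_meanZ c F : perm_mean (fun p => c * F p) = c * perm_mean F.
Proof. by rewrite /perm_mean -mulr_sumr mulrA. Qed.

Lemma perm_meanN F : perm_mean (fun p => - F p) = - perm_mean F.
Proof. by rewrite /perm_mean sumrN mulNr. Qed.

Lemma perm_meanB F G :
  perm_mean (fun p => F p - G p) = perm_mean F - perm_mean G.
Proof. by rewrite perm_meanD perm_meanN. Qed.

Lemma perm_mean_sum (I : finType) (F : I -> 'S_n -> R) :
  perm_mean (fun p => \sum_i F i p) = \sum_i perm_mean (F i).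
Proof. by rewrite /perm_mean exchange_big mulr_suml. Qed.

Lemma fact_gt0R : 0 < n`!%:R :> R.
Proof. by rewrite ltr0n fact_gt0. Qed.

Lemma perm_mean_cst c : perm_mean (fun=> c) = c.
Proof.
rewrite /perm_mean sumr_const card_Sn -[X in X / _]mulr_natr.
by rewrite mulfK // gt_eqF // fact_gt0R.
Qed.

Lemma perm_mean_le F G : (forall p, F p <= G p) -> perm_mean F <= perm_mean G.
Proof.
move=> FG; rewrite ler_wpM2r ?invr_ge0 ?(ltW fact_gt0R) //.
by apply: ler_sum => p _.
Qed.

Lemma perm_mean_ge0 F : (forall p, 0 <= F p) -> 0 <= perm_mean F.
Proof. by move=> F0; rewrite -(perm_mean_cst 0); exact: perm_mean_le. Qed.

Lemma ler_norm_perm_mean F : `|perm_mean F| <= perm_mean (fun p => `|F p|).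
Proof.
rewrite normrM normfV (ger0_norm (ltW fact_gt0R)).
by rewrite ler_wpM2r ?invr_ge0 ?(ltW fact_gt0R) // ler_norm_sum.
Qed.

Definition rearranged y (p : 'S_n) : 'I_n -> R := fun v => y (p v).

Lemma swapped_rearranged y p i j :
  swapped (rearranged y p) i j = rearranged y (tperm i j * p)%g.
Proof. by apply/funext => v; rewrite /swapped /rearranged permM. Qed.

Lemma perm_mean_swapped H y i j :
  perm_mean (fun p => H (swapped (rearranged y p) i j))
  = perm_mean (fun p => H (rearranged y p)).
Proof.
under [LHS]eq_perm_mean do rewrite swapped_rearranged.
by rewrite /perm_mean (sum_shift (fun p => H (rearranged y p))).
Qed.

Lemma sum_rearranged (f : R -> R) y p :
  \sum_v f (rearranged y p v) = \sum_v f (y v).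
Proof. by rewrite [RHS](reindex_inj (@perm_inj _ p)). Qed.

End perm_mean.

Section moments.
Context (R : realFieldType) (n : nat) (m : R) (y : 'I_n -> R).
Context (ysum : \sum_v y v = 0) (ysq : forall v, (y v + m) ^+ 2 = 1).
Let rho := 1 - m ^+ 2.
Let Y (v : 'I_n) (p : 'S_n) := rearranged y p v.

Let Ysq u p : Y u p ^+ 2 = rho - 2 * m * Y u p.
Proof. exact: (sqr_centered ysq). Qed.

Lemma swapped_other (x : 'I_n -> R) (i j v : 'I_n) : v != i -> v != j ->
  swapped x i j v = x v.
Proof. by move=> vi vj; rewrite /swapped tpermD // eq_sym. Qed.

(** All mixed moments of distinct entries follow from this constraint and from
    exchangeability, which makes the terms of the sum equal. *)
Lemma perm_mean_sum0 (F : 'S_n -> R) : \sum_v perm_mean (fun p => F p * Y v p) = 0.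
Proof.
rewrite -perm_mean_sum -[RHS](perm_mean_cst n); apply: eq_perm_mean => p.
by rewrite -mulr_sumr (sum_rearranged id) ysum mulr0.
Qed.

Lemma perm_mean1 v : perm_mean (Y v) = 0.
Proof.
have := perm_mean_sum0 (fun=> 1).
have E w : perm_mean (fun p => 1 * Y w p) = perm_mean (Y v).
  rewrite -(perm_mean_swapped (fun x => x v) y v w); apply: eq_perm_mean => p.
  by rewrite /swapped tpermL mul1r.
under eq_bigr do rewrite E.
rewrite sumr_const card_ord -[X in X = _]mulr_natr => /eqP; rewrite mulf_eq0 pnatr_eq0.
by case/orP => /eqP // n0; have := ltn_ord v; rewrite [X in (_ < X)%N]n0.
Qed.

Lemma perm_mean_sqr v : perm_mean (fun p => Y v p ^+ 2) = rho.
Proof.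
transitivity (perm_mean (fun p => rho - 2 * m * Y v p)).
  by apply: eq_perm_mean => p; exact: (sqr_centered ysq).
by rewrite perm_meanB perm_mean_cst perm_meanZ perm_mean1 mulr0 subr0.
Qed.

Definition moment2 : R := - rho / (n%:R - 1).

Lemma perm_mean2 u v : u != v -> perm_mean (fun p => Y u p * Y v p) = moment2.
Proof.
move=> uv.
have n1 : n%:R - 1 != 0 :> R.
  rewrite subr_eq0 (eqr_nat R n 1).
  apply: contraNneq uv => n1; have := ltn_ord u; have := ltn_ord v.
  rewrite [X in (_ < X)%N -> _]n1 [X in _ -> (_ < X)%N -> _]n1 !ltnS !leqn0.
  by move=> /eqP v0 /eqP u0; rewrite -val_eqE /= u0 v0.
have := perm_mean_sum0 (Y u); rewrite (bigD1 u) //=.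
have -> : perm_mean (fun p => Y u p * Y u p) = rho.
  by rewrite -(perm_mean_sqr u); apply: eq_perm_mean => p; rewrite expr2.
rewrite (eq_bigr (fun=> perm_mean (fun p => Y u p * Y v p))) => [|w wu].
  rewrite sumr_const cardC1 card_ord -mulr_natr -subn1 natrB.
    by rewrite addrC => /eqP; rewrite addr_eq0 /moment2 => /eqP <-; rewrite mulfK.
  exact: leq_ltn_trans (leq0n _) (ltn_ord u).
rewrite -(perm_mean_swapped (fun x => x u * x v) y v w).
by apply: eq_perm_mean => p; rewrite swapped_other // 1?eq_sym // /swapped tpermL.
Qed.

Lemma perm_mean_sqr_mul u v : u != v ->
  perm_mean (fun p => Y u p ^+ 2 * Y v p) = - 2 * m * moment2.
Proof.
move=> uv; rewrite -(perm_mean2 uv) -perm_meanZ.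
transitivity (perm_mean (fun p => rho * Y v p + - 2 * m * (Y u p * Y v p))).
  by apply: eq_perm_mean => p; rewrite Ysq; ring.
by rewrite perm_meanD !perm_meanZ perm_mean1 mulr0 add0r.
Qed.

Definition moment3 : R := 4 * m * moment2 / (n%:R - 2).

Lemma perm_mean3 u v w : u != v -> u != w -> v != w ->
  perm_mean (fun p => Y u p * Y v p * Y w p) = moment3.
Proof.
move=> uv uw vw.
have n3 : (2 < n)%N.
  have : (#|[set u; v; w]| <= #|'I_n|)%N by exact: max_card.
  rewrite card_ord; suff -> : #|[set u; v; w]| = 3 by [].
  rewrite finset.setUC cardsU1 cards2 uv !inE negb_or.
  by rewrite (eq_sym w u) (eq_sym w v) uw vw.
have n2 : n%:R - 2 != 0 :> R by rewrite subr_eq0 (eqr_nat R n 2) gtn_eqF.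
have := perm_mean_sum0 (fun p => Y u p * Y v p).
rewrite (bigD1 u) //= (bigD1 v) 1?eq_sym //=.
have -> : perm_mean (fun p => Y u p * Y v p * Y u p) = - 2 * m * moment2.
  by rewrite -(perm_mean_sqr_mul uv); apply: eq_perm_mean => p; rewrite expr2 mulrAC.
have -> : perm_mean (fun p => Y u p * Y v p * Y v p) = - 2 * m * moment2.
  rewrite -(perm_mean_sqr_mul (u := v) (v := u)) 1?eq_sym //.
  by apply: eq_perm_mean => p; rewrite expr2; ring.
rewrite (eq_bigr (fun=> perm_mean (fun p => Y u p * Y v p * Y w p))) => [|z].
  rewrite sumr_const.
  have -> : #|[pred i | (i != u) && (i != v)]| = (n - 2)%N.
    have := cardC [set u; v]; rewrite cards2 uv card_ord => card_uv.
    rewrite -[X in (X - 2)%N]card_uv addKn.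
    by apply: eq_card => z; rewrite !inE negb_or.
  rewrite -[perm_mean _ *+ _]mulr_natr natrB ?(ltnW n3) // /moment3 => E.
  apply: (mulIf n2); rewrite mulfVK //; move: E; lra.
case/andP => zu zv.
rewrite -(perm_mean_swapped (fun x => x u * x v * x w) y w z).
rewrite eq_sym in zu; rewrite eq_sym in zv; apply: eq_perm_mean => p.
by rewrite !(swapped_other _ uw zu, swapped_other _ vw zv) /swapped tpermL.
Qed.

End moments.


(** * The variance of the form *)

Section graph_moments.
Context (R : realFieldType) (n : nat) (a : 'I_n -> 'I_n -> R) (D : R).
Context (asym : forall i j, a i j = a j i) (adiag : forall i, a i i = 0)
  (a_idem : forall i j, a i j * a i j = a i j)
  (adeg : forall i, \sum_j a i j = D).
Context (m : R) (y : 'I_n -> R).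
Context (ysum : \sum_v y v = 0) (ysq : forall v, (y v + m) ^+ 2 = 1).
Let rho := 1 - m ^+ 2.
Let Y (p : 'S_n) := rearranged y p.
Let N p := nbr_sum a (Y p).
Let q p := graph_form a (Y p).
Let mu2 := moment2 n m.
Let mu3 := moment3 n m.

Lemma rearranged_sum p : \sum_v Y p v = 0.
Proof. by rewrite (sum_rearranged id). Qed.

Lemma rearranged_sq p v : (Y p v + m) ^+ 2 = 1.
Proof. exact: ysq. Qed.

(** Sums over pairs of neighbours of v, for summands depending only on whether the
    two neighbours coincide; all second-order averages below have this shape. *)
Lemma sum_adj2_diag v (A B : R) :
  \sum_k \sum_l a v k * a v l * (A + (k == l)%:R * B) = D ^+ 2 * A + D * B.
Proof.
transitivity (\sum_k (a v k * (D * A) + a v k * B)).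
  apply: eq_bigr => k _; rewrite -(adeg v) mulr_suml mulr_sumr.
  have -> : a v k * B = a v k * \sum_l (l == k)%:R * (a v l * B).
    by rewrite sum_eq_mul mulrA a_idem.
  rewrite mulr_sumr -big_split; apply: eq_bigr => l _ /=.
  by rewrite (eq_sym l); ring.
by rewrite big_split -!mulr_suml adeg expr2 mulrA.
Qed.

Lemma nbr_sum_sqr p v :
  N p v ^+ 2 = \sum_k \sum_l a v k * a v l * (Y p k * Y p l).
Proof.
rewrite expr2 mulr_suml; apply: eq_bigr => k _.
by rewrite mulr_sumr; apply: eq_bigr => l _; ring.
Qed.

Lemma perm_mean_nbr_sqr v :
  perm_mean (fun p => N p v ^+ 2) = D * rho + (D ^+ 2 - D) * mu2.
Proof.
under eq_perm_mean do rewrite nbr_sum_sqr.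
rewrite perm_mean_sum.
under eq_bigr => k _.
  rewrite perm_mean_sum; under eq_bigr => l _.
    rewrite perm_meanZ.
    have -> : perm_mean (fun p => Y p k * Y p l) = mu2 + (k == l)%:R * (rho - mu2).
      have [->|kl] := eqVneq k l; last by rewrite (perm_mean2 ysum ysq) // mul0r addr0.
      transitivity rho; last by rewrite /=; ring.
      rewrite -[RHS](perm_mean_sqr ysum ysq l).
      by apply: eq_perm_mean => p; rewrite expr2.
    over.
  over.
by rewrite sum_adj2_diag; ring.
Qed.

Lemma perm_mean_weighted_nbr_sqr v :
  perm_mean (fun p => Y p v * N p v ^+ 2)
  = D * (- 2 * m * mu2) + (D ^+ 2 - D) * mu3.
Proof.
under eq_perm_mean do rewrite nbr_sum_sqr mulr_sumr.
rewrite perm_mean_sum.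
transitivity (\sum_k \sum_l a v k * a v l *
  (mu3 + (k == l)%:R * (- 2 * m * mu2 - mu3))); last first.
  by rewrite sum_adj2_diag; ring.
apply: eq_bigr => k _.
under eq_perm_mean do rewrite mulr_sumr.
rewrite perm_mean_sum; apply: eq_bigr => l _.
under eq_perm_mean do rewrite mulrCA.
rewrite perm_meanZ.
have [->|vk] := eqVneq v k; first by rewrite adiag !mul0r.
have [->|vl] := eqVneq v l; first by rewrite adiag mulr0 !mul0r.
congr (_ * _); have [<-|kl] := eqVneq k l.
  transitivity (- 2 * m * mu2); last by rewrite /=; ring.
  rewrite -[RHS](perm_mean_sqr_mul ysum ysq (u := k) (v := v)) 1?eq_sym //.
  by apply: eq_perm_mean => p; rewrite expr2 mulrC.
rewrite mul0r addr0 -[RHS](perm_mean3 ysum ysq vk vl kl).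
by apply: eq_perm_mean => p; rewrite mulrA.
Qed.

Lemma perm_mean_form : perm_mean q = 2^-1 * (n%:R * D * mu2).
Proof.
rewrite /q /graph_form perm_meanZ perm_mean_sum; congr (_ * _).
rewrite -mulrA mulr_natl -[n in RHS]card_ord -sumr_const; apply: eq_bigr => v _.
under eq_perm_mean do rewrite mulr_sumr.
rewrite perm_mean_sum -(adeg v) mulr_suml; apply: eq_bigr => k _.
under eq_perm_mean do rewrite mulrCA.
rewrite perm_meanZ; have [->|vk] := eqVneq v k; first by rewrite adiag !mul0r.
by rewrite (perm_mean2 ysum ysq).
Qed.

Definition form_variance : R := perm_mean (fun p => (q p - perm_mean q) ^+ 2).

Definition swap_square p : R := \sum_i \sum_j swap_diff q i j p ^+ 2.

Lemma swap_diff_form i j p :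
  swap_diff q i j p = graph_form a (swapped (Y p) i j) - graph_form a (Y p).
Proof. by rewrite /swap_diff swapped_rearranged. Qed.

Lemma swap_squareE p : swap_square p =
  4 * \sum_v (n%:R * (rho - m * Y p v) - 4) * N p v ^+ 2
  + 16 * q p ^+ 2 + (32 * D - 16) * q p + 8 * D * n%:R * rho.
Proof.
rewrite -(sum_sqr_graph_form_swapped asym adiag a_idem adeg
  (rearranged_sum p) (rearranged_sq p)).
by apply: eq_bigr => i _; apply: eq_bigr => j _; rewrite swap_diff_form.
Qed.

Lemma swap_laplacian_form p :
  swap_laplacian q p = - 4 * (n%:R - 1) * (q p - perm_mean q).
Proof.
have E r : swap_laplacian q r = - 4 * (n%:R - 1) * q r - 2 * D * n%:R * rho.
  rewrite -(sum_graph_form_swapped asym adiag adeg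
    (rearranged_sum r) (rearranged_sq r)).
  by apply: eq_bigr => i _; apply: eq_bigr => j _; rewrite swap_diff_form.
have : perm_mean (swap_laplacian q) = 0.
  have := sum_laplacianM (fun=> 1 : R) q; rewrite /perm_mean.
  under eq_bigr do rewrite mul1r; move=> ->.
  rewrite big1 ?mulr0 ?mul0r // => i _; rewrite big1 // => j _.
  by rewrite big1 // => r _; rewrite /swap_diff subrr mul0r.
have -> : perm_mean (swap_laplacian q) =
    - 4 * (n%:R - 1) * perm_mean q - 2 * D * n%:R * rho.
  rewrite -perm_meanZ -[X in _ - X](perm_mean_cst n) -perm_meanB.
  exact: eq_perm_mean.
by rewrite E => /eqP; rewrite subr_eq0 => /eqP <-; ring.
Qed.

(** Summation by parts, applied to the eigenfunction with itself. *)
Lemma perm_mean_swap_square :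
  perm_mean swap_square = 8 * (n%:R - 1) * form_variance.
Proof.
pose qc p := q p - perm_mean q.
have := sum_laplacianM qc q.
under eq_bigr => p _ do rewrite swap_laplacian_form mulrCA -expr2.
rewrite -mulr_sumr.
have -> : \sum_i \sum_j \sum_p swap_diff qc i j p * swap_diff q i j p =
   \sum_p swap_square p.
  under [RHS]eq_bigr => p _ do rewrite /swap_square.
  rewrite [RHS]exchange_big; apply: eq_bigr => i _ /=.
  rewrite [RHS]exchange_big; apply: eq_bigr => j _ /=.
  by apply: eq_bigr => p _; rewrite /swap_diff /qc; ring.
move=> E; have {}E : \sum_p swap_square p = 8 * (n%:R - 1) * \sum_p qc p ^+ 2.
  by move: E; lra.
by rewrite /perm_mean E mulrA.
Qed.

(** Both sides of [perm_mean_swap_square] contain the variance, since [swap_square]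
    contains q^2; this is why its coefficient is 8 n - 24. *)
Lemma form_variance_eq :
  (8 * n%:R - 24) * form_variance =
  4 * n%:R * (n%:R * rho * (D * rho + (D ^+ 2 - D) * mu2)
     - m * n%:R * (D * (- 2 * m * mu2) + (D ^+ 2 - D) * mu3))
  + 4 * n%:R ^+ 2 * D ^+ 2 * mu2 ^+ 2
  - 16 * n%:R * (D * rho + (D ^+ 2 - D) * mu2)
  + (16 * D - 8) * n%:R * D * mu2 + 8 * D * n%:R * rho.
Proof.
have := perm_mean_swap_square.
under eq_perm_mean do rewrite swap_squareE.
rewrite !perm_meanD !perm_meanZ perm_mean_cst.
have -> : perm_mean (fun p => q p ^+ 2) = form_variance + perm_mean q ^+ 2.
  rewrite /form_variance.
  transitivity (perm_mean (fun p => q p ^+ 2 - 2 * perm_mean q * q p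
    + perm_mean q ^+ 2) + perm_mean q ^+ 2).
    by rewrite perm_meanD perm_meanB perm_meanZ perm_mean_cst; ring.
  by congr (_ + _); apply: eq_perm_mean => p; ring.
have -> : perm_mean (fun p => \sum_v (n%:R * (rho - m * Y p v) - 4) * N p v ^+ 2)
   = n%:R * ((n%:R * rho - 4) * (D * rho + (D ^+ 2 - D) * mu2)
     - m * n%:R * (D * (- 2 * m * mu2) + (D ^+ 2 - D) * mu3)).
  have sum_cst x : n%:R * x = \sum_(v < n) x.
    by rewrite sumr_const card_ord mulr_natl.
  rewrite perm_mean_sum [RHS]sum_cst.
  apply: eq_bigr => v _.
  rewrite -(perm_mean_nbr_sqr v) -(perm_mean_weighted_nbr_sqr v).
  rewrite -!perm_meanZ -perm_meanB; apply: eq_perm_mean => p.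
  by ring.
rewrite -(perm_meanZ 2^-1) -/q perm_mean_form; lra.
Qed.

End graph_moments.


Lemma weighted_cauchy_schwarz (R : realFieldType) (I : finType) (w b : I -> R) :
  (forall i, 0 <= w i) ->
  (\sum_i w i * b i) ^+ 2 <= (\sum_i w i) * \sum_i w i * b i ^+ 2.
Proof.
move=> w0.
have : 0 <= \sum_i \sum_j w i * w j * (b i - b j) ^+ 2.
  by do 2![apply: sumr_ge0 => ? _]; rewrite mulr_ge0 ?sqr_ge0 // mulr_ge0.
have -> : \sum_i \sum_j w i * w j * (b i - b j) ^+ 2 =
    2 * ((\sum_i w i) * (\sum_i w i * b i ^+ 2)) - 2 * (\sum_i w i * b i) ^+ 2.
  transitivity (\sum_i \sum_j (w i * (w j * b j ^+ 2))
    + \sum_i \sum_j (w i * b i ^+ 2) * w j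
    + (- 2) * \sum_i \sum_j (w i * b i) * (w j * b j)).
    rewrite mulr_sumr -!big_split; apply: eq_bigr => i _ /=.
    rewrite mulr_sumr -!big_split; apply: eq_bigr => j _ /=.
    by ring.
  have S (f g : I -> R) : \sum_i \sum_j f i * g j = (\sum_i f i) * (\sum_j g j).
    by rewrite mulr_suml; apply: eq_bigr => i _; rewrite mulr_sumr.
  by rewrite !S; ring.
lra.
Qed.

Lemma normM_le (R : realFieldType) (x y a b : R) :
  `|x| <= a -> `|y| <= b -> `|x * y| <= a * b.
Proof. by move=> xa yb; rewrite normrM ler_pM. Qed.

Section moment_bounds.
Context (R : realFieldType) (n : nat) (m : R).

Lemma moment2_bound : (6 <= n)%N -> m ^+ 2 <= 1 -> `|n%:R * moment2 n m| <= 2.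
Proof.
rewrite -(ler_nat R) => n6 m1; have m0 := sqr_ge0 m.
rewrite /moment2 mulrA mulrN mulNr normrN ger0_norm; last first.
  by apply: divr_ge0; [apply: mulr_ge0 => // | ]; lra.
rewrite ler_pdivrMr; last by lra.
have : n%:R * (1 - m ^+ 2) <= n%:R * 1 by apply: ler_wpM2l => //; lra.
lra.
Qed.

Lemma norm_le1_of_sqr : m ^+ 2 <= 1 -> `|m| <= 1.
Proof. by move=> m1; rewrite ler_norml; apply/andP; split; nra. Qed.

Lemma moment3_bound : (6 <= n)%N -> m ^+ 2 <= 1 ->
  `|n%:R ^+ 2 * moment3 n m| <= 16.
Proof.
move=> n6 m1; have n6' : 6 <= n%:R :> R by rewrite (ler_nat R 6 n).
have -> : n%:R ^+ 2 * moment3 n m =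
    4 * (m * ((n%:R * moment2 n m) * (n%:R / (n%:R - 2)))).
  by rewrite /moment3; field; apply/eqP; lra.
rewrite (_ : 16 = 4 * (1 * (2 * 2))); last by ring.
apply: normM_le; first by rewrite ger0_norm.
apply: normM_le; first exact: norm_le1_of_sqr.
apply: normM_le; first exact: moment2_bound.
rewrite ger0_norm; last by apply: divr_ge0 => //; lra.
by rewrite ler_pdivrMr; lra.
Qed.

End moment_bounds.

(** The leading term of the equation is 4 n^2 D rho^2, since n mu2 and n^2 mu3 are
    bounded; the other terms, with 12 n D rho^2 from the left-hand side, total at
    most 220 n D^2, and 8 n - 24 >= 4 n. *)
Lemma form_variance_estimate (R : realFieldType) (n : nat) (D m V : R) :
  let rho := 1 - m ^+ 2 in
  (6 <= n)%N -> m ^+ 2 <= 1 -> 1 <= D ->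
  (8 * n%:R - 24) * V =
  4 * n%:R * (n%:R * rho * (D * rho + (D ^+ 2 - D) * moment2 n m)
     - m * n%:R * (D * (- 2 * m * moment2 n m) + (D ^+ 2 - D) * moment3 n m))
  + 4 * n%:R ^+ 2 * D ^+ 2 * moment2 n m ^+ 2
  - 16 * n%:R * (D * rho + (D ^+ 2 - D) * moment2 n m)
  + (16 * D - 8) * n%:R * D * moment2 n m + 8 * D * n%:R * rho ->
  `|V - 2^-1 * n%:R * D * rho ^+ 2| <= 55 * D ^+ 2.
Proof.
move=> rho n6 m1 D1 EV; have n6' : 6 <= n%:R :> R by rewrite (ler_nat R 6 n).
have m0 := sqr_ge0 m.
have rho0 : 0 <= rho by rewrite /rho; lra.
have rho1 : rho <= 1 by rewrite /rho; lra.
have A2 := moment2_bound n6 m1; have B16 := moment3_bound n6 m1.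
have mn := norm_le1_of_sqr m1.
set A := n%:R * _ in A2; set B := _ * moment3 n m in B16.
set N : R := n%:R in n6' *.
have DD : 0 <= D ^+ 2 - D by rewrite expr2; nra.
have rn : `|rho| <= 1 by rewrite ger0_norm.
have ET : (8 * N - 24) * (V - 2^-1 * N * D * rho ^+ 2) =
  N * D * (12 * (rho * rho) - 8 * rho)
  + N * (D ^+ 2 - D) * (4 * (rho * A))
  + N * D * (8 * (m * (m * A)))
  - (D ^+ 2 - D) * (4 * (m * B))
  + D ^+ 2 * (4 * (A * A))
  - (D ^+ 2 - D) * (16 * A) + (D ^+ 2 + (D ^+ 2 - D)) * (8 * A).
  by rewrite mulrBr EV /A /B -/N; field.
have ND : N * D <= N * D ^+ 2.
  by apply: ler_wpM2l; [lra | rewrite expr2; nra].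
have NDD : N * (D ^+ 2 - D) <= N * D ^+ 2 by apply: ler_wpM2l; lra.
have ND2 : 6 * D ^+ 2 <= N * D ^+ 2 by apply: ler_wpM2r; rewrite ?sqr_ge0.
have bnd (c x b : R) : 0 <= c -> `|x| <= b -> - (c * b) <= c * x /\ c * x <= c * b.
  move=> c0; rewrite ler_norml => /andP[x1 x2]; split; last exact: ler_wpM2l.
  by rewrite -mulrN; apply: ler_wpM2l.
have ND0 : 0 <= N * D by apply: mulr_ge0; lra.
have NDD0 : 0 <= N * (D ^+ 2 - D) by apply: mulr_ge0; lra.
have rr : 0 <= rho * rho <= 1 by rewrite mulr_ge0 //= mulr_ile1.
have [a1 a2] : - (N * D * 12) <= N * D * (12 * (rho * rho) - 8 * rho) /\
   N * D * (12 * (rho * rho) - 8 * rho) <= N * D * 12.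
  by apply: bnd => //; rewrite ler_norml; lra.
have [b1 b2] : - (N * (D ^+ 2 - D) * (4 * (1 * 2))) <= N * (D ^+ 2 - D) * (4 * (rho * A))
    /\ N * (D ^+ 2 - D) * (4 * (rho * A)) <= N * (D ^+ 2 - D) * (4 * (1 * 2)).
  by apply: bnd => //; do ![apply: normM_le => //]; rewrite ger0_norm.
have [c1 c2] : - (N * D * (8 * (1 * (1 * 2)))) <= N * D * (8 * (m * (m * A)))
    /\ N * D * (8 * (m * (m * A))) <= N * D * (8 * (1 * (1 * 2))).
  by apply: bnd => //; do ![apply: normM_le => //]; rewrite ger0_norm.
have [d1 d2] : - ((D ^+ 2 - D) * (4 * (1 * 16))) <= (D ^+ 2 - D) * (4 * (m * B))
    /\ (D ^+ 2 - D) * (4 * (m * B)) <= (D ^+ 2 - D) * (4 * (1 * 16)).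
  by apply: bnd => //; do ![apply: normM_le => //]; rewrite ger0_norm.
have [e1 e2] : - (D ^+ 2 * (4 * (2 * 2))) <= D ^+ 2 * (4 * (A * A))
    /\ D ^+ 2 * (4 * (A * A)) <= D ^+ 2 * (4 * (2 * 2)).
  by apply: bnd; rewrite ?sqr_ge0 //; do ![apply: normM_le => //]; rewrite ger0_norm.
have [f1 f2] : - ((D ^+ 2 - D) * (16 * 2)) <= (D ^+ 2 - D) * (16 * A)
    /\ (D ^+ 2 - D) * (16 * A) <= (D ^+ 2 - D) * (16 * 2).
  by apply: bnd => //; do ![apply: normM_le => //]; rewrite ger0_norm.
have [g1 g2] : - ((D ^+ 2 + (D ^+ 2 - D)) * (8 * 2)) <= (D ^+ 2 + (D ^+ 2 - D)) * (8 * A)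
    /\ (D ^+ 2 + (D ^+ 2 - D)) * (8 * A) <= (D ^+ 2 + (D ^+ 2 - D)) * (8 * 2).
  apply: bnd; last by do ![apply: normM_le => //]; rewrite ger0_norm.
  by rewrite addr_ge0 ?sqr_ge0.
have T : `|(8 * N - 24) * (V - 2^-1 * N * D * rho ^+ 2)| <= 220 * (N * D ^+ 2).
  by rewrite ET ler_norml; apply/andP; split; lra.
have p : 0 < 8 * N - 24 by lra.
rewrite normrM (ger0_norm (ltW p)) in T.
have : (8 * N - 24) * `|V - 2^-1 * N * D * rho ^+ 2| <= (8 * N - 24) * (55 * D ^+ 2).
  by lra.
by rewrite ler_pM2l.
Qed.


(** * Fluctuations of the squared increments *)

Lemma sqrD_le (R : realDomainType) (u v : R) :
  (u + v) ^+ 2 <= 2 * u ^+ 2 + 2 * v ^+ 2.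
Proof. by have := sqr_ge0 (u - v); rewrite sqrrB sqrrD; lra. Qed.

Section swap_variation.
Context (R : realFieldType) (n : nat) (a : 'I_n -> 'I_n -> R) (D : R).
Context (asym : forall i j, a i j = a j i) (adiag : forall i, a i i = 0)
  (a_idem : forall i j, a i j * a i j = a i j)
  (adeg : forall i, \sum_j a i j = D).
Context (m : R) (m1 : m ^+ 2 <= 1).
Let rho := 1 - m ^+ 2.

Lemma adj_ge0 i j : 0 <= a i j.
Proof. by rewrite -a_idem -expr2 sqr_ge0. Qed.

Lemma adj_le1 i j : a i j <= 1.
Proof. by have := a_idem i j; have := adj_ge0 i j; nra. Qed.

Context (y : 'I_n -> R) (ysq : forall v, (y v + m) ^+ 2 = 1).

Lemma centered_norm_le2 v : `|y v| <= 2.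
Proof.
have := norm_le1_of_sqr m1; have : `|y v + m| <= 1.
  by apply: norm_le1_of_sqr; rewrite ysq.
by rewrite !ler_norml => /andP[? ?] /andP[? ?]; apply/andP; split; lra.
Qed.

Lemma centered_diff_le2 i j : `|y j - y i| <= 2.
Proof.
have h v : `|y v + m| <= 1 by apply: norm_le1_of_sqr; rewrite ysq.
by have := h i; have := h j; rewrite !ler_norml => /andP[? ?] /andP[? ?];
  apply/andP; split; lra.
Qed.

Lemma nbr_sum_le v : `|nbr_sum a y v| <= 2 * D.
Proof.
apply: le_trans (ler_norm_sum _ _ _) _.
rewrite -(adeg v) mulr_sumr; apply: ler_sum => k _.
rewrite normrM (ger0_norm (adj_ge0 _ _)) mulrC.
by rewrite ler_wpM2r ?adj_ge0 // centered_norm_le2.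
Qed.

Lemma graph_form_le : `|graph_form a y| <= 2 * n%:R * D.
Proof.
have le : `|\sum_v y v * nbr_sum a y v| <= \sum_(v < n) 2 * (2 * D).
  apply: le_trans (ler_norm_sum _ _ _) _; apply: ler_sum => v _.
  by apply: normM_le; [exact: centered_norm_le2 | exact: nbr_sum_le].
have E : \sum_(v < n) 2 * (2 * D) = n%:R * (2 * (2 * D)).
  by rewrite sumr_const card_ord [RHS]mulr_natl.
rewrite /graph_form normrM (ger0_norm (x := 2^-1)) ?invr_ge0 //.
by move: le; rewrite E; lra.
Qed.

Lemma graph_form_diff_le i j : 1 <= D ->
  `|graph_form a (swapped y i j) - graph_form a y| <= 12 * D.
Proof.
move=> D1; rewrite (graph_form_swapped asym adiag).
have t2 := centered_diff_le2 i j; set t := y j - y i in t2 *.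
have b1 : `|t * (nbr_sum a y i - nbr_sum a y j)| <= 2 * (2 * D + 2 * D).
  apply: normM_le => //; apply: le_trans (ler_normB _ _) _.
  by apply: lerD; exact: nbr_sum_le.
have b2 : `|a i j * (t * t)| <= 1 * (2 * 2).
  apply: normM_le; last exact: normM_le.
  by rewrite ger0_norm ?adj_ge0 ?adj_le1.
rewrite expr2; apply: le_trans (ler_normB _ _) _; lra.
Qed.

(** A quarter of the part of [swap_square] that is not a function of the form
    alone. *)
Definition weighted_nbr (x : 'I_n -> R) : R :=
  \sum_v (n%:R * (rho - m * x v) - 4) * nbr_sum a x v ^+ 2.

Lemma weight_le v : (2 <= n)%N -> `|n%:R * (rho - m * y v) - 4| <= 2 * n%:R.
Proof.
rewrite -(ler_nat R) => n2.
have h : `|m * (y v + m)| <= 1 * 1.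
  by apply: normM_le; apply: norm_le1_of_sqr; rewrite ?ysq.
have -> : n%:R * (rho - m * y v) - 4 = n%:R * (1 - m * (y v + m)) - 4.
  by rewrite /rho; ring.
move: h; rewrite mul1r !ler_norml; set u := m * _ => /andP[u1 u2].
have : 0 <= n%:R * (1 - u) by apply: mulr_ge0 => //; lra.
have : n%:R * (1 - u) <= n%:R * 2 by apply: ler_wpM2l => //; lra.
by move=> ? ?; apply/andP; split; lra.
Qed.

End swap_variation.

Section swap_square_variation.
Context (R : realFieldType) (n : nat) (a : 'I_n -> 'I_n -> R) (D : R).
Context (asym : forall i j, a i j = a j i) (adiag : forall i, a i i = 0)
  (a_idem : forall i j, a i j * a i j = a i j)
  (adeg : forall i, \sum_j a i j = D).
Context (m : R) (m1 : m ^+ 2 <= 1).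
Context (y : 'I_n -> R) (ysq : forall v, (y v + m) ^+ 2 = 1).
Let rho := 1 - m ^+ 2.
Let N := nbr_sum a y.
Let G := weighted_nbr a m.

(** An exchange of y_i and y_j changes the neighbour sums only at neighbours of i
    or j, by at most 2, and the weights only at i and j. At i and j the square of
    the neighbour sum is estimated by 2 D times its absolute value, so that second
    moments of neighbour sums suffice later on. *)
Lemma weighted_nbr_diff_le i j : (2 <= n)%N ->
  `|G (swapped y i j) - G y| <=
  8 * n%:R * \sum_v (a v i + a v j) * (`|N v| + 1)
  + 4 * n%:R * D * (`|N i| + `|N j|).
Proof.
move=> n2.
set y' := swapped y i j; set N' := nbr_sum a y'.
have y'sq v : (y' v + m) ^+ 2 = 1 by exact: ysq.
pose c (x : 'I_n -> R) v := n%:R * (rho - m * x v) - 4.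
have -> : G y' - G y = \sum_v c y' v * (N' v ^+ 2 - N v ^+ 2)
    - n%:R * (m * (y j - y i)) * (N i ^+ 2 - N j ^+ 2).
  transitivity (\sum_v c y' v * (N' v ^+ 2 - N v ^+ 2)
    - n%:R * (m * (y j - y i)) * (\sum_v (v == i)%:R * N v ^+ 2
       - \sum_v (v == j)%:R * N v ^+ 2)); last by rewrite !sum_eq_mul.
  rewrite /G /weighted_nbr -!sumrB mulr_sumr -sumrB; apply: eq_bigr => v _.
  by rewrite -/N -/N' /c /rho /y' swappedE; ring.
apply: le_trans (ler_normB _ _) _; apply: lerD.
  apply: le_trans (ler_norm_sum _ _ _) _; rewrite mulr_sumr.
  apply: ler_sum => v _.
  rewrite [X in _ <= X](_ : _ =
    2 * n%:R * (4 * ((a v i + a v j) * (`|N v| + 1)))); last by ring.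
  apply: normM_le; first exact: (weight_le m1 y'sq).
  rewrite /N' nbr_sum_swapped -/N; set t := y j - y i.
  have t2 : `|t| <= 2 by exact: (centered_diff_le2 ysq).
  set w := a v i - a v j.
  have wle : `|w| <= a v i + a v j.
    have := adj_ge0 a_idem v i; have := adj_ge0 a_idem v j.
    by rewrite ler_norml /w => ? ?; apply/andP; split; lra.
  have w1 : `|w| <= 1.
    have := adj_ge0 a_idem v i; have := adj_ge0 a_idem v j.
    have := adj_le1 a_idem v i; have := adj_le1 a_idem v j.
    by rewrite ler_norml /w => ? ? ? ?; apply/andP; split; lra.
  rewrite (_ : _ - _ = t * (w * (2 * N v + w * t))); last by ring.
  rewrite (_ : 4 * _ = 2 * ((a v i + a v j) * (2 * `|N v| + 1 * 2))); last by ring.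
  apply: normM_le => //; apply: normM_le => //.
  apply: le_trans (ler_normD _ _) _; apply: lerD; last exact: normM_le.
  by rewrite normrM ger0_norm.
have -> : n%:R * (m * (y j - y i)) * (N i ^+ 2 - N j ^+ 2) =
  n%:R * ((m * (y j - y i)) * (N i * N i - N j * N j)) by ring.
rewrite (_ : 4 * _ * _ * _ = n%:R * ((1 * 2) * (2 * D * `|N i| + 2 * D * `|N j|)));
  last by ring.
have N2 v : `|N v| <= 2 * D by exact: (nbr_sum_le a_idem adeg m1 ysq).
apply: normM_le; first by rewrite ger0_norm.
apply: normM_le.
  by apply: normM_le; [exact: norm_le1_of_sqr | exact: (centered_diff_le2 ysq)].
apply: le_trans (ler_normB _ _) _.
by apply: lerD; apply: normM_le.
Qed.

Lemma sum_adj_pair (f : 'I_n -> R) :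
  \sum_i \sum_j \sum_v (a v i + a v j) * f v = 2 * n%:R * D * \sum_v f v.
Proof.
transitivity (\sum_(i < n) \sum_(j < n) \sum_v a v i * f v
   + \sum_(i < n) \sum_(j < n) \sum_v a v j * f v).
  rewrite -big_split; apply: eq_bigr => i _ /=.
  rewrite -big_split; apply: eq_bigr => j _ /=.
  by rewrite -big_split; apply: eq_bigr => v _ /=; rewrite mulrDl.
have E : \sum_i \sum_v a v i * f v = D * \sum_v f v.
  rewrite exchange_big mulr_sumr; apply: eq_bigr => v _ /=.
  by rewrite -mulr_suml adeg.
rewrite sum_sum_left sum_sum_right E; ring.
Qed.

(** Cauchy-Schwarz with weights [a v i + a v j] of total mass 2 D keeps a single
    factor D^2 in front of the sum of the squared neighbour sums. *)
Lemma sum_weighted_nbr_diff_sqr : (2 <= n)%N -> 1 <= D ->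
  \sum_i \sum_j (G (swapped y i j) - G y) ^+ 2 <=
  1152 * n%:R ^+ 3 * D ^+ 2 * (\sum_v N v ^+ 2 + n%:R).
Proof.
move=> n2 D1.
have a0 v k := adj_ge0 a_idem v k.
have le1 i j : (G (swapped y i j) - G y) ^+ 2 <=
   512 * n%:R ^+ 2 * D * (\sum_v (a v i + a v j) * (N v ^+ 2 + 1))
   + 64 * n%:R ^+ 2 * D ^+ 2 * (N i ^+ 2 + N j ^+ 2).
  set T := \sum_v _ * (_ ^+ 2 + 1).
  have := weighted_nbr_diff_le i j n2.
  set S := \sum_v _ => le.
  have S2 : S ^+ 2 <= 4 * D * T.
    apply: le_trans (weighted_cauchy_schwarz _ _) _ => [v|].
      by rewrite addr_ge0.
    have -> : \sum_v (a v i + a v j) = 2 * D.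
      have E k : \sum_v a v k = D by rewrite -(adeg k); apply: eq_bigr => v _.
      by rewrite big_split /= !E; ring.
    rewrite (_ : 4 * D * T = 2 * D * (2 * T)); last by ring.
    apply: ler_wpM2l; first by lra.
    rewrite mulr_sumr; apply: ler_sum => v _.
    rewrite [X in _ <= X]mulrCA; apply: ler_wpM2l; first by rewrite addr_ge0.
    apply: le_trans (sqrD_le _ _) _.
    by rewrite expr1n real_normK ?num_real //; lra.
  have le' : `|G (swapped y i j) - G y| ^+ 2 <=
      (8 * n%:R * S + 4 * n%:R * D * (`|N i| + `|N j|)) ^+ 2.
    by rewrite ler_sqr ?nnegrE // (le_trans _ le).
  rewrite -real_normK ?num_real //; apply: le_trans le' _.
  apply: le_trans (sqrD_le _ _) _; apply: lerD.
    rewrite exprMn; set u := 8 * _; rewrite (_ : 512 * _ * _ * _ =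
      2 * (u ^+ 2 * (4 * D * T))); last by rewrite /u; ring.
    by apply: ler_wpM2l => //; apply: ler_wpM2l; rewrite ?sqr_ge0.
  have := sqrD_le `|N i| `|N j|; rewrite !real_normK ?num_real // => h.
  rewrite exprMn; set u := 4 * _ * D.
  rewrite (_ : 64 * _ * _ * _ = 2 * (u ^+ 2 * (2 * N i ^+ 2 + 2 * N j ^+ 2)));
    last by rewrite /u; ring.
  by apply: ler_wpM2l => //; apply: ler_wpM2l; rewrite ?sqr_ge0.
apply: le_trans (ler_sum _ (fun i _ => ler_sum _ (fun j _ => le1 i j))) _.
have [M EM] : exists M, M = N by exists N.
rewrite -EM.
under eq_bigr => i _ do rewrite big_split -!mulr_sumr.
rewrite big_split -!mulr_sumr sum_adj_pair /=.
have -> : \sum_(i < n) \sum_(j < n) (M i ^+ 2 + M j ^+ 2) =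
    2 * n%:R * \sum_v M v ^+ 2.
  transitivity (\sum_(i < n) \sum_(j < n) M i ^+ 2
    + \sum_(i < n) \sum_(j < n) M j ^+ 2).
    by rewrite -big_split; apply: eq_bigr => i _; rewrite -big_split.
  by rewrite sum_sum_left sum_sum_right; ring.
rewrite big_split /= sumr_const card_ord.
set S := \sum_v _.
have S0 : 0 <= S by apply: sumr_ge0 => v _; exact: sqr_ge0.
have : 0 <= n%:R ^+ 3 * D ^+ 2 * n%:R
  by apply: mulr_ge0 => //; apply: mulr_ge0; [exact: exprn_ge0 | exact: sqr_ge0].
have -> : 1152 * n%:R ^+ 3 * D ^+ 2 * (S + n%:R) =
  1024 * n%:R ^+ 3 * D ^+ 2 * (S + n%:R) + 128 * n%:R ^+ 3 * D ^+ 2 * S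
  + 128 * (n%:R ^+ 3 * D ^+ 2 * n%:R) by ring.
have -> : 512 * n%:R ^+ 2 * D * (2 * n%:R * D * (S + n%:R)) +
  64 * n%:R ^+ 2 * D ^+ 2 * (2 * n%:R * S) =
  1024 * n%:R ^+ 3 * D ^+ 2 * (S + n%:R) + 128 * n%:R ^+ 3 * D ^+ 2 * S by ring.
lra.
Qed.

End swap_square_variation.


Lemma poincare_perm_mean (R : realFieldType) (n : nat) (F : 'S_n -> R) :
  (2 < n)%N ->
  4 * (n%:R - 2) * perm_mean (fun p => (F p - perm_mean F) ^+ 2)
  <= perm_mean (fun p => \sum_i \sum_j swap_diff F i j p ^+ 2).
Proof.
move=> n2; pose G p := F p - perm_mean F.
have G0 : \sum_p G p = 0.
  have : perm_mean G = 0 by rewrite perm_meanB perm_mean_cst subrr.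
  move/eqP; rewrite mulf_eq0 invr_eq0 (gt_eqF (fact_gt0R R n)) orbF.
  by move/eqP.
have := poincare_perm n2 G0.
have -> : swap_energy G = \sum_p \sum_i \sum_j swap_diff F i j p ^+ 2.
  rewrite [RHS]exchange_big; apply: eq_bigr => i _ /=.
  rewrite [RHS]exchange_big; apply: eq_bigr => j _ /=.
  by apply: eq_bigr => p _; rewrite /swap_diff /G; ring.
move=> h; rewrite /perm_mean mulrA; apply: ler_wpM2r h.
by rewrite invr_ge0 (ltW (fact_gt0R R n)).
Qed.

Section swap_square_variance.
Context (R : realFieldType) (n : nat) (a : 'I_n -> 'I_n -> R) (D : R).
Context (asym : forall i j, a i j = a j i) (adiag : forall i, a i i = 0)
  (a_idem : forall i j, a i j * a i j = a i j)
  (adeg : forall i, \sum_j a i j = D).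
Context (m : R) (y : 'I_n -> R).
Context (ysum : \sum_v y v = 0) (ysq : forall v, (y v + m) ^+ 2 = 1).
Let Y (p : 'S_n) := rearranged y p.
Let q p := graph_form a (Y p).
Let Gam := swap_square a y.

Lemma form_variance_bound : (6 <= n)%N -> m ^+ 2 <= 1 -> 1 <= D ->
  `|form_variance a y - 2^-1 * n%:R * D * (1 - m ^+ 2) ^+ 2| <= 55 * D ^+ 2.
Proof.
move=> n6 m1 D1; apply: form_variance_estimate => //.
exact: (form_variance_eq asym adiag a_idem adeg ysum ysq).
Qed.

Lemma form_variance_le : (6 <= n)%N -> m ^+ 2 <= 1 -> 1 <= D -> D <= n%:R ->
  form_variance a y <= 56 * n%:R * D.
Proof.
move=> n6 m1 D1 Dn; have := form_variance_bound n6 m1 D1.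
have m0 := sqr_ge0 m.
rewrite ler_norml => /andP[_].
have : (1 - m ^+ 2) ^+ 2 <= 1 by rewrite expr_le1 //; lra.
set r := _ ^+ 2 => r1; have nD : 0 <= n%:R * D by apply: mulr_ge0 => //; lra.
have : n%:R * D * r <= n%:R * D * 1 by apply: ler_wpM2l.
have : D * D <= n%:R * D by apply: ler_wpM2r => //; lra.
by rewrite expr2; lra.
Qed.

Lemma swap_square_diff_le i j p : (6 <= n)%N -> m ^+ 2 <= 1 -> 1 <= D ->
  swap_diff Gam i j p ^+ 2 <=
  32 * (weighted_nbr a m (swapped (Y p) i j) - weighted_nbr a m (Y p)) ^+ 2
  + 2 * 112 ^+ 2 * (n%:R * D) ^+ 2 * swap_diff q i j p ^+ 2.
Proof.
move=> n6 m1 D1.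
have n6' : 6 <= n%:R :> R by rewrite (ler_nat R 6 n).
have -> : swap_diff Gam i j p =
    4 * (weighted_nbr a m (swapped (Y p) i j) - weighted_nbr a m (Y p))
    + swap_diff q i j p *
      (16 * (q (tperm i j * p)%g + q p) + 32 * D - 16).
  have E r : Gam r = 4 * weighted_nbr a m (Y r) + 16 * q r ^+ 2
      + (32 * D - 16) * q r + 8 * D * n%:R * (1 - m ^+ 2).
    exact: (swap_squareE asym adiag a_idem adeg ysum ysq).
  by rewrite /swap_diff !E swapped_rearranged; ring.
apply: le_trans (sqrD_le _ _) _; apply: lerD.
  by rewrite exprMn; lra.
rewrite exprMn (_ : 2 * 112 ^+ 2 * (_ ^+ 2) * _ = 2 * (swap_diff q i j p ^+ 2 *
  (112 * (n%:R * D)) ^+ 2)); last by ring.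
apply: ler_wpM2l => //; apply: ler_wpM2l; first exact: sqr_ge0.
rewrite -[X in X <= _]real_normK ?num_real // ler_sqr ?nnegrE //; last first.
  by rewrite !mulr_ge0 //; lra.
have q1 r : `|q r| <= 2 * n%:R * D.
  by apply: (graph_form_le a_idem adeg m1) => v; exact: ysq.
have := q1 p; have := q1 (tperm i j * p)%g.
have DnD : 1 * D <= n%:R * D by apply: ler_wpM2r; lra.
rewrite !ler_norml => /andP[? ?] /andP[? ?]; apply/andP; split; lra.
Qed.

(** Poincare's inequality. The squared neighbour sums average to at most D each, so
    the energy has order (n D)^3 n, and the gap gains the factor n. *)
Lemma swap_square_variance_le :
  (6 <= n)%N -> m ^+ 2 <= 1 -> 1 <= D -> D <= n%:R ->
  perm_mean (fun p => (Gam p - perm_mean Gam) ^+ 2)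
  <= 12 * 100 ^+ 3 * (n%:R * D) ^+ 3.
Proof.
move=> n6 m1 D1 Dn.
have n6' : 6 <= n%:R :> R by rewrite (ler_nat R 6 n).
have n2 : (2 < n)%N by apply: leq_trans n6.
have n2' : (2 <= n)%N by apply: leq_trans n6.
have := poincare_perm_mean Gam n2.
set V := perm_mean (fun p => (_ - _) ^+ 2) => le.
have V0 : 0 <= V by apply: perm_mean_ge0 => p; exact: sqr_ge0.
pose S p := \sum_v nbr_sum a (Y p) v ^+ 2.
have pt p : \sum_i \sum_j swap_diff Gam i j p ^+ 2 <=
    32 * 1152 * n%:R ^+ 3 * D ^+ 2 * (S p + n%:R)
    + 2 * 112 ^+ 2 * (n%:R * D) ^+ 2 * swap_square a y p.
  apply: le_trans (ler_sum _ (fun i _ => ler_sum _ (fun j _ =>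
    swap_square_diff_le i j p n6 m1 D1))) _.
  under eq_bigr => i _ do rewrite big_split -!mulr_sumr.
  rewrite big_split -!mulr_sumr; apply: lerD; last by [].
  rewrite (_ : 32 * 1152 * _ * _ * (S p + _) =
    32 * (1152 * n%:R ^+ 3 * D ^+ 2 * (S p + n%:R))); last by ring.
  apply: ler_wpM2l => //.
  exact: (sum_weighted_nbr_diff_sqr asym a_idem adeg m1 (rearranged_sq ysq p)).
have := le_trans le (perm_mean_le pt).
rewrite perm_meanD !perm_meanZ perm_meanD perm_mean_cst.
rewrite (perm_mean_swap_square asym adiag adeg ysum ysq).
have -> : perm_mean S = n%:R * (D * (1 - m ^+ 2) + (D ^+ 2 - D) * moment2 n m).
  rewrite perm_mean_sum.
  under eq_bigr do rewrite (perm_mean_nbr_sqr a_idem adeg ysum ysq).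
  by rewrite sumr_const card_ord [RHS]mulr_natl.
have m0 := sqr_ge0 m.
have h1 : D * (1 - m ^+ 2) + (D ^+ 2 - D) * moment2 n m <= D.
  have : D * (1 - m ^+ 2) <= D * 1 by apply: ler_wpM2l; lra.
  have : 0 <= (D ^+ 2 - D) * - moment2 n m.
    apply: mulr_ge0; first by rewrite expr2; nra.
    by rewrite /moment2 mulNr opprK; apply: divr_ge0; lra.
  lra.
set W := _ + _ * moment2 n m in h1 *.
have h2 := form_variance_le n6 m1 D1 Dn.
set U := form_variance a y in h2 *.
have nD0 : 0 <= n%:R * D by apply: mulr_ge0; lra.
have k1 : n%:R ^+ 3 * D ^+ 2 * (n%:R * W + n%:R) <=
    n%:R ^+ 3 * D ^+ 2 * (2 * (n%:R * D)).
  apply: ler_wpM2l; first by apply: mulr_ge0; [exact: exprn_ge0 | exact: sqr_ge0].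
  have : n%:R * W <= n%:R * D by apply: ler_wpM2l => //; lra.
  have : n%:R * 1 <= n%:R * D by apply: ler_wpM2l => //; lra.
  lra.
have k2 : (n%:R * D) ^+ 2 * (8 * (n%:R - 1) * U) <=
   (n%:R * D) ^+ 2 * (448 * n%:R * (n%:R * D)).
  apply: ler_wpM2l; first exact: sqr_ge0.
  have : (n%:R - 1) * U <= (n%:R - 1) * (56 * n%:R * D) by apply: ler_wpM2l; lra.
  lra.
have k3 : n%:R * V <= 4 * (n%:R - 2) * V by apply: ler_wpM2r => //; lra.
move=> H; have n0 : 0 < n%:R :> R by lra.
rewrite -(ler_pM2l n0); apply: le_trans k3 _; apply: le_trans H _.
set x : R := n%:R in k1 k2 nD0 *.
have -> : x * (12 * 100 ^+ 3 * (x * D) ^+ 3) =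
  12 * 100 ^+ 3 * ((x * D) ^+ 2 * (x * (x * D))) by ring.
have e1 : x ^+ 3 * D ^+ 2 * (2 * (x * D)) = 2 * ((x * D) ^+ 2 * (x * (x * D))).
  by ring.
have : 0 <= (x * D) ^+ 2 * (x * (x * D)).
  by apply: mulr_ge0; [exact: sqr_ge0 | apply: mulr_ge0 => //; lra].
move: k1 k2; rewrite e1.
rewrite (_ : (x * D) ^+ 2 * (448 * x * (x * D)) =
  448 * ((x * D) ^+ 2 * (x * (x * D)))); last by ring.
set Z := _ * (x * (x * D)); lra.
Qed.

End swap_square_variance.


(** * Stein's method for an eigenfunction of the walk *)

(** Summation by parts writes 2 lam E (W f(W)) as the mean of
    (f(W') - f(W)) (W' - W) summed over all exchanges W' of W; a first-order
    expansion of f replaces f(W') - f(W) by g(W) (W' - W). *)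
Lemma stein_eigenfunction (R : realFieldType) (n : nat) (W : 'S_n -> R)
    (lam B Lam del : R) (f g : R -> R) :
  0 < lam -> (forall p, swap_laplacian W p = - lam * W p) ->
  perm_mean (fun p => W p ^+ 2) = 1 ->
  (forall w, `|g w| <= B) ->
  (forall w w', `|f w' - f w - g w * (w' - w)| <= Lam * (w' - w) ^+ 2) ->
  (forall i j p, `|swap_diff W i j p| <= del) ->
  `|perm_mean (fun p => g (W p) - W p * f (W p))| <=
  B * perm_mean (fun p =>
    `|1 - (\sum_i \sum_j swap_diff W i j p ^+ 2) / (2 * lam)|) + Lam * del.
Proof.
move=> lam0 eig W1 gB fT delW.
have Lam0 : 0 <= Lam.
  by have := fT 0 1; rewrite subr0 expr1n !mulr1 => /(le_trans (normr_ge0 _)).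
pose Gam p := \sum_i \sum_j swap_diff W i j p ^+ 2.
have exch (h : 'I_n -> 'I_n -> 'S_n -> R) :
    \sum_i \sum_j \sum_p h i j p = \sum_p \sum_i \sum_j h i j p.
  rewrite [RHS]exchange_big; apply: eq_bigr => i _ /=.
  by rewrite [RHS]exchange_big; apply: eq_bigr => j _ /=.
have green F : 2 * lam * perm_mean (fun p => F p * W p) =
    perm_mean (fun p => \sum_i \sum_j swap_diff F i j p * swap_diff W i j p).
  have := sum_laplacianM F W; rewrite exch.
  under eq_bigr do rewrite eig mulrCA.
  rewrite -mulr_sumr /perm_mean => E; rewrite mulrA; congr (_ / _).
  by move: E; lra.
have GamE : perm_mean Gam = 2 * lam.
  have := green W; under eq_perm_mean do rewrite -expr2.
  rewrite W1 mulr1 => ->; apply: eq_perm_mean => p.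
  by apply: eq_bigr => i _; apply: eq_bigr => j _; rewrite expr2.
have fW : 2 * lam * perm_mean (fun p => W p * f (W p)) =
    perm_mean (fun p => \sum_i \sum_j
      (f (W (tperm i j * p)%g) - f (W p)) * swap_diff W i j p).
  by rewrite -(green (fun p => f (W p))); congr (_ * _);
    apply: eq_perm_mean => p; rewrite mulrC.
have l2 : 0 < 2 * lam by lra.
pose E p := \sum_i \sum_j
  (f (W (tperm i j * p)%g) - f (W p) - g (W p) * swap_diff W i j p)
    * swap_diff W i j p.
have -> : perm_mean (fun p => g (W p) - W p * f (W p)) =
    perm_mean (fun p => g (W p) * (1 - Gam p / (2 * lam))) - perm_mean E / (2 * lam).
  apply: (mulfI (lt0r_neq0 l2)).
  transitivity (2 * lam * perm_mean (fun p => g (W p) * (1 - Gam p / (2 * lam)))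
    - perm_mean E); last by field; rewrite lt0r_neq0.
  rewrite [in LHS]perm_meanB [LHS]mulrBr fW -!perm_meanZ -!perm_meanB.
  apply: eq_perm_mean => p.
  have -> : \sum_i \sum_j
      (f (W (tperm i j * p)%g) - f (W p)) * swap_diff W i j p = E p + g (W p) * Gam p.
    rewrite /E /Gam mulr_sumr -big_split; apply: eq_bigr => i _ /=.
    by rewrite mulr_sumr -big_split; apply: eq_bigr => j _ /=; ring.
  by field; rewrite lt0r_neq0.
apply: le_trans (ler_normB _ _) _; apply: lerD.
  apply: le_trans (ler_norm_perm_mean _) _; rewrite -perm_meanZ.
  by apply: perm_mean_le => p; apply: normM_le.
rewrite normrM normfV (gtr0_norm l2) ler_pdivrMr //.
apply: le_trans (ler_norm_perm_mean _) _.
rewrite -GamE -perm_meanZ; apply: perm_mean_le => p.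
apply: le_trans (ler_norm_sum _ _ _) _; rewrite mulr_sumr; apply: ler_sum => i _.
apply: le_trans (ler_norm_sum _ _ _) _; rewrite mulr_sumr; apply: ler_sum => j _.
rewrite -mulrA (mulrC del) mulrA; apply: normM_le; last exact: delW.
exact: fT.
Qed.

(** Young's inequality 2 |F| <= k + F^2 / k, with k standing for the expected size
    of F. *)
Lemma perm_mean_norm_le (R : realFieldType) (n : nat) (F : 'S_n -> R) (k : R) :
  0 < k -> perm_mean (fun p => `|F p|) <= 2^-1 * (k + perm_mean (fun p => F p ^+ 2) / k).
Proof.
move=> k0.
have : perm_mean (fun p => 2 * `|F p|) <= perm_mean (fun p => k + k^-1 * F p ^+ 2).
  apply: perm_mean_le => p.
  have := sqr_ge0 (`|F p| - k); rewrite sqrrB real_normK ?num_real // => h.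
  rewrite -(ler_pM2l k0) mulrDr mulVKf ?gt_eqF //.
  by rewrite -expr2; move: h; lra.
rewrite perm_meanZ perm_meanD perm_mean_cst perm_meanZ; lra.
Qed.

Section stein_graph.
Context (R : rcfType) (n : nat) (a : 'I_n -> 'I_n -> R) (D : R).
Context (asym : forall i j, a i j = a j i) (adiag : forall i, a i i = 0)
  (a_idem : forall i j, a i j * a i j = a i j)
  (adeg : forall i, \sum_j a i j = D).
Context (m : R) (y : 'I_n -> R).
Context (ysum : \sum_v y v = 0) (ysq : forall v, (y v + m) ^+ 2 = 1).
Let q p := graph_form a (rearranged y p).
Let V := form_variance a y.
Let W p := (q p - perm_mean q) / Num.sqrt V.

Lemma form_variance_ge (rho : R) : (6 <= n)%N -> 1 <= D -> rho = 1 - m ^+ 2 ->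
  0 <= rho -> 220 * D <= n%:R * rho ^+ 2 ->
  4^-1 * (n%:R * D * rho ^+ 2) <= V.
Proof.
move=> n6 D1 rhoE rho0 small.
have m1 : m ^+ 2 <= 1 by lra.
have := form_variance_bound asym adiag a_idem adeg ysum ysq n6 m1 D1.
rewrite -rhoE ler_norml => /andP[+ _]; rewrite -/V.
have : D * (220 * D) <= D * (n%:R * rho ^+ 2) by apply: ler_wpM2l => //; lra.
by rewrite (expr2 D); lra.
Qed.

(** Here e^2 = sqrt (D / n). The standard deviation is at least
    rho sqrt (n D) / 2 and the increments of the form are at most 12 D, whence
    24 / rho e^2; the relative fluctuation of the squared increments is O(e^2). *)
Lemma stein_graph_form (rho e B Lam : R) (f g : R -> R) :
  (6 <= n)%N -> 1 <= D -> D <= n%:R -> rho = 1 - m ^+ 2 -> 0 < rho ->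
  220 * D <= n%:R * rho ^+ 2 -> 0 < e -> e ^+ 4 = D / n%:R ->
  (forall w, `|g w| <= B) ->
  (forall w w', `|f w' - f w - g w * (w' - w)| <= Lam * (w' - w) ^+ 2) ->
  `|perm_mean (fun p => g (W p) - W p * f (W p))| <=
  (7 * 100 ^+ 3 / rho ^+ 2 * B + 24 / rho * Lam) * e ^+ 2.
Proof.
move=> n6 D1 Dn rhoE rho0 small e0 e4 gB fT.
have n6' : 6 <= n%:R :> R by rewrite (ler_nat R 6 n).
have m1 : m ^+ 2 <= 1 by lra.
have B0 : 0 <= B by exact: le_trans (gB 0).
have Lam0 : 0 <= Lam.
  by have := fT 0 1; rewrite subr0 expr1n !mulr1 => /(le_trans (normr_ge0 _)).
have r2 : 0 < rho ^+ 2 by rewrite exprn_gt0.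
have n0 : 0 < n%:R :> R by lra.
have D0 : 0 < D by lra.
have nD0 : 0 < n%:R * D by exact: mulr_gt0.
have Vge := form_variance_ge n6 D1 rhoE (ltW rho0) small.
have V0 : 0 < V.
  by apply: lt_le_trans Vge; rewrite mulr_gt0 ?invr_gt0 // mulr_gt0.
have s0 : 0 < Num.sqrt V by rewrite sqrtr_gt0.
have sV : Num.sqrt V ^+ 2 = V by rewrite sqr_sqrtr // ltW.
set s := Num.sqrt V in s0 sV.
have dW i j p : swap_diff W i j p = swap_diff q i j p / s.
  by rewrite /swap_diff /W -/s; field; rewrite gt_eqF.
have lam0 : 0 < 4 * (n%:R - 1) :> R by lra.
have eig p : swap_laplacian W p = - (4 * (n%:R - 1)) * W p.
  transitivity (swap_laplacian q p / s).
    rewrite /swap_laplacian mulr_suml; apply: eq_bigr => i _.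
    by rewrite mulr_suml; apply: eq_bigr => j _.
  have -> : swap_laplacian q p = - 4 * (n%:R - 1) * (q p - perm_mean q).
    exact: (swap_laplacian_form asym adiag adeg ysum ysq).
  by rewrite /W -/s; ring.
have W1 : perm_mean (fun p => W p ^+ 2) = 1.
  transitivity (perm_mean (fun p => V^-1 * (q p - perm_mean q) ^+ 2)).
    by apply: eq_perm_mean => p; rewrite /W -/s exprMn exprVn sV mulrC.
  by rewrite perm_meanZ -/V mulVf // gt_eqF.
have dle i j p : `|swap_diff W i j p| <= 24 / rho * e ^+ 2.
  rewrite dW normrM normfV (gtr0_norm s0) ler_pdivrMr //.
  have d12 : `|swap_diff q i j p| <= 12 * D.
    rewrite /q (swap_diff_form a y).
    exact: (graph_form_diff_le asym adiag a_idem adeg m1 (rearranged_sq ysq p)).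
  apply: le_trans d12 _.
  have p0 : 0 <= 24 / rho * e ^+ 2 * s.
    apply: mulr_ge0 (ltW s0); apply: mulr_ge0 (sqr_ge0 _).
    by apply: divr_ge0 => //; exact: ltW.
  have p1 : 0 <= 12 * D by lra.
  rewrite -ler_sqr ?nnegrE // [X in _ <= X]exprMn sV.
  have -> : (12 * D) ^+ 2 = 144 * (D / n%:R) * (n%:R * D).
    by field; rewrite gt_eqF.
  have -> : (24 / rho * e ^+ 2) ^+ 2 = 576 / rho ^+ 2 * (D / n%:R).
    by rewrite -e4; field; rewrite gt_eqF.
  have c0 : 0 <= 576 / rho ^+ 2 * (D / n%:R).
    by apply: mulr_ge0; apply: divr_ge0; lra.
  apply: le_trans (ler_wpM2l c0 Vge).
  rewrite le_eqVlt; apply/orP; left; apply/eqP.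
  by field; rewrite !gt_eqF.
apply: le_trans (stein_eigenfunction lam0 eig W1 gB fT dle) _.
rewrite [X in _ <= X](_ : _ = B * (7 * 100 ^+ 3 / rho ^+ 2 * e ^+ 2)
  + Lam * (24 / rho * e ^+ 2)); last by ring.
rewrite lerD2r; apply: ler_wpM2l => //.
pose L := 8 * (n%:R - 1) * V.
pose Gam := swap_square a y.
have EGam : perm_mean Gam = L.
  by rewrite (perm_mean_swap_square asym adiag adeg ysum ysq).
have L0 : n%:R ^+ 2 * D * rho ^+ 2 <= L.
  have -> : n%:R ^+ 2 * D * rho ^+ 2 = 4 * n%:R * (4^-1 * (n%:R * D * rho ^+ 2)).
    by field.
  apply: le_trans (ler_wpM2l _ Vge) _; first by lra.
  by rewrite /L; apply: ler_wpM2r; lra.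
have Lp : 0 < L by rewrite /L; apply: mulr_gt0 => //; lra.
have -> : perm_mean (fun p => `|1 - (\sum_i \sum_j swap_diff W i j p ^+ 2)
     / (2 * (4 * (n%:R - 1)))|) = perm_mean (fun p => `|Gam p - perm_mean Gam|) / L.
  rewrite [RHS]mulrC -perm_meanZ; apply: eq_perm_mean => p.
  rewrite -[L^-1]gtr0_norm ?invr_gt0 // -normrM distrC EGam; congr `|_|.
  have -> : \sum_i \sum_j swap_diff W i j p ^+ 2 = Gam p / V.
    rewrite /Gam /swap_square mulr_suml; apply: eq_bigr => i _.
    rewrite mulr_suml; apply: eq_bigr => j _.
    by rewrite dW exprMn exprVn sV.
  rewrite /L; field; rewrite (gt_eqF V0) /=.
  by apply/eqP; lra.
rewrite ler_pdivrMr //.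
(* The scale at which both terms of Young's inequality balance. *)
have k0 : 0 < n%:R ^+ 2 * D * e ^+ 2 by rewrite !mulr_gt0 // exprn_gt0.
apply: le_trans (perm_mean_norm_le _ k0) _.
have v := swap_square_variance_le asym adiag a_idem adeg ysum ysq n6 m1 D1 Dn.
have : perm_mean (fun p => (Gam p - perm_mean Gam) ^+ 2) / (n%:R ^+ 2 * D * e ^+ 2)
    <= 12 * 100 ^+ 3 * (n%:R ^+ 2 * D * e ^+ 2).
  rewrite ler_pdivrMr //; apply: le_trans v _.
  rewrite le_eqVlt; apply/orP; left; apply/eqP.
  transitivity (12 * 100 ^+ 3 * (n%:R ^+ 4 * D ^+ 2 * e ^+ 4)); last by ring.
  by rewrite e4; field; rewrite gt_eqF.
have : 7 * 100 ^+ 3 / rho ^+ 2 * e ^+ 2 * (n%:R ^+ 2 * D * rho ^+ 2) <=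
   7 * 100 ^+ 3 / rho ^+ 2 * e ^+ 2 * L.
  apply: ler_wpM2l => //; apply: mulr_ge0; last exact: sqr_ge0.
  by apply: divr_ge0; [lra | exact: ltW].
have -> : 7 * 100 ^+ 3 / rho ^+ 2 * e ^+ 2 * (n%:R ^+ 2 * D * rho ^+ 2) =
  7 * 100 ^+ 3 * (n%:R ^+ 2 * D * e ^+ 2) by field; rewrite gt_eqF.
set k := n%:R ^+ 2 * _ * _ in k0 *.
set z := _ / k.
lra.
Qed.

End stein_graph.

Local Open Scope classical_set_scope.
Local Open Scope ring_scope.

(** * Solutions of Stein's equation on the line *)

Section gauss.
Context (R : realType).
Implicit Types (f g k h : R -> R) (x t : R).

Definition gauss : R -> R := normal_pdf 0 1.

Lemma gaussE x : gauss x = normal_peak 1 * expR (- (2^-1 * x ^+ 2)).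
Proof.
rewrite /gauss normal_pdfE ?oner_eq0 // /normal_fun subr0 expr1n.
by congr (_ * expR _); field.
Qed.

Lemma gauss_gt0 x : 0 < gauss x.
Proof. by rewrite gaussE mulr_gt0 ?expR_gt0 // normal_peak_gt0 ?oner_eq0. Qed.

Lemma normal_peak_le1 : normal_peak 1 <= 1 :> R.
Proof.
rewrite /normal_peak expr1n mul1r invf_le1; last first.
  by rewrite sqrtr_gt0 mulrn_wgt0 // pi_gt0.
rewrite -[X in X <= _]sqrtr1 ler_sqrt; last by rewrite mulrn_wge0 // pi_ge0.
by have := pi_ge2 R; lra.
Qed.

Lemma gauss_le1 x : gauss x <= 1.
Proof.
rewrite gaussE mulr_ile1 ?normal_peak_le1 ?normal_peak_ge0 ?expR_ge0 //.
by rewrite -expR0 ler_expR oppr_le0 mulr_ge0 ?sqr_ge0.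
Qed.

Instance is_derive_gauss x : is_derive x 1 gauss (- (x * gauss x)).
Proof.
have E : gauss = normal_peak 1 *: (expR \o (fun t => - (2^-1 * t ^+ 2))).
  by apply/funext => t; rewrite gaussE.
rewrite [X in is_derive _ _ X]E; apply: is_derive_eq; rewrite gaussE /=.
rewrite /GRing.scale /=.
by field.
Qed.

(** An epsilon form of convergence to 0 at both ends of the line, which is
    stable under reflection. *)
Definition vanishing f := forall e : R, 0 < e ->
  exists M : R, forall x, M <= `|x| -> `|f x| <= e.

Lemma vanishing_gauss f (C : R) : (forall x, `|f x| <= C) ->
  vanishing (fun x => f x * gauss x).
Proof.
move=> fC e e0; have C0 : 0 <= C by exact: le_trans (fC 0).
exists (2 * C / e + 1) => x Mx.
have x1 : 1 <= `|x|.
  by apply: le_trans Mx; rewrite lerDr divr_ge0 ?mulr_ge0 // ltW.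
rewrite normrM (gtr0_norm (gauss_gt0 x)).
apply: le_trans (ler_wpM2r (ltW (gauss_gt0 x)) (fC x)) _.
have y0 : 0 < 2^-1 * x ^+ 2.
  by rewrite mulr_gt0 ?invr_gt0 // exprn_even_gt0 /= -?normr_gt0 ?(lt_le_trans _ x1).
have g1 : gauss x * (2^-1 * x ^+ 2) <= 1.
  rewrite gaussE expRN -mulrA mulr_ile1 ?normal_peak_ge0 ?normal_peak_le1 //.
    by rewrite mulr_ge0 ?invr_ge0 ?expR_ge0 // ltW.
  rewrite mulrC ler_pdivrMr ?expR_gt0 // mul1r.
  apply: le_trans (expR_ge1Dx _); rewrite lerDr //.
rewrite -(ler_pM2r y0) -mulrA; apply: le_trans (ler_wpM2l C0 g1) _.
rewrite mulr1 -real_normK ?num_real //.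
have h : 2 * C / e <= `|x| by apply: le_trans Mx; rewrite lerDl.
rewrite ler_pdivrMr // in h.
have : `|x| * e * 1 <= `|x| * e * `|x| by rewrite ler_wpM2l // mulr_ge0 // ltW.
by rewrite expr2; lra.
Qed.

Lemma mean_value f df a b : a <= b ->
  (forall x, a <= x -> x <= b -> is_derive x 1 f (df x)) ->
  exists2 c, a <= c <= b & f b - f a = df c * (b - a).
Proof.
move=> ab dfx.
have cont : {within `[a, b], continuous f}.
  apply: derivable_within_continuous => x; rewrite in_itv /= => /andP[? ?].
  by have [] : is_derive x 1 f (df x) by exact: dfx.
have dfo x : x \in `]a, b[ -> is_derive x 1 f (df x).
  by rewrite in_itv /= => /andP[/ltW ? /ltW ?]; exact: dfx.
have [c] := MVT_segment ab dfo cont.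
by rewrite in_itv /=; exists c.
Qed.

Lemma nondecreasing_derive f df a b : a <= b ->
  (forall x, a <= x -> x <= b -> is_derive x 1 f (df x)) ->
  (forall x, a <= x -> x <= b -> 0 <= df x) -> f a <= f b.
Proof.
move=> ab dfx df0; have [c /andP[ac cb] E] := mean_value ab dfx.
by rewrite -subr_ge0 E mulr_ge0 ?subr_ge0 // df0.
Qed.

(** Comparison of [f * gauss] with [B * gauss x / x], a supersolution of the
    same first-order equation which vanishes at infinity. *)
Lemma stein_pos f k (B : R) x :
  (forall t, is_derive t 1 f (t * f t + k t)) -> (forall t, `|k t| <= B) ->
  vanishing (fun t => f t * gauss t) -> 0 < x -> x * f x <= B.
Proof.
move=> df kB van x0.
have B0 : 0 <= B by exact: le_trans (kB 0).
pose H t := f t * gauss t - B * (t^-1 * gauss t).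
pose dH t := (k t + B) * gauss t + B * (t^-2 * gauss t).
have dHE t : 0 < t -> is_derive t 1 H (dH t).
  move=> t0; rewrite /H.
  have dinv : is_derive t 1 (fun z : R => z^-1) (- t ^- 2).
    have := @is_deriveV R id t 1 1 _ (is_derive_id _ _).
    rewrite /= => /(_ (lt0r_neq0 t0)).
    by rewrite -[_ *: 1]/(_ * 1) mulr1.
  have -> : (fun z => f z * gauss z - B * (z^-1 * gauss z)) =
      f * gauss - B *: ((fun z : R => z^-1) * gauss) by [].
  have dg := is_derive_gauss t.
  apply: is_derive_eq; rewrite /GRing.scale /dH /=.
  by field; rewrite gt_eqF.
have dH0 t : 0 < t -> 0 <= dH t.
  move=> t0; have := kB t; rewrite ler_norml => /andP[k1 _].
  have g0 := ltW (gauss_gt0 t).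
  rewrite addr_ge0 // mulr_ge0 //; first by lra.
  by rewrite mulr_ge0 // invr_ge0 sqr_ge0.
have H0 : H x <= 0.
  apply/ler_addgt0Pr => e e0; rewrite add0r.
  have [M vM] := van e e0.
  pose z := Num.max x M; have xz : x <= z by rewrite le_max lexx.
  have z0 : 0 < z by exact: lt_le_trans xz.
  have /vM fz : M <= `|z| by rewrite ger0_norm ?(ltW z0) // le_max lexx orbT.
  apply: (@le_trans _ _ (H z)).
    apply: (nondecreasing_derive xz (df := dH)) => t xt _.
      by apply: dHE; exact: lt_le_trans xt.
    by apply: dH0; exact: lt_le_trans xt.
  apply: le_trans (le_trans (ler_norm _) fz).
  rewrite lerBlDr lerDl; apply: mulr_ge0 => //.
  by apply: mulr_ge0; rewrite ?invr_ge0 ltW // gauss_gt0.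
have := H0; rewrite /H mulrA -mulrBl pmulr_lle0 ?gauss_gt0 // subr_le0 => h.
by rewrite mulrC -ler_pdivlMr.
Qed.

Lemma vanishing_opp f : vanishing f -> vanishing (fun x => - f x).
Proof. by move=> v e /v[M vM]; exists M => x /vM; rewrite normrN. Qed.

Lemma vanishing_reflect f : vanishing f -> vanishing (fun x => f (- x)).
Proof. by move=> v e /v[M vM]; exists M => x Mx; apply: vM; rewrite normrN. Qed.

Lemma gaussN x : gauss (- x) = gauss x.
Proof. by rewrite !gaussE sqrrN. Qed.

(** The equation is invariant under f -> - f and under reflection, which reduces
    the bound to [stein_pos]. *)
Lemma stein_mul_bound f k (B : R) :
  (forall t, is_derive t 1 f (t * f t + k t)) -> (forall t, `|k t| <= B) ->
  vanishing (fun t => f t * gauss t) -> forall x, `|x * f x| <= B.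
Proof.
have pos f0 k0 : (forall t, is_derive t 1 f0 (t * f0 t + k0 t)) ->
    (forall t, `|k0 t| <= B) -> vanishing (fun t => f0 t * gauss t) ->
    forall x, 0 < x -> `|x * f0 x| <= B.
  move=> df kB van x x0; rewrite ler_norml; apply/andP; split.
    rewrite lerNl -mulrN; apply: (@stein_pos (- f0) (fun t => - k0 t)) => //.
    - move=> t; have dft := df t.
      by apply: is_derive_eq; rewrite /= opprD mulrN.
    - by move=> t; rewrite normrN.
    - by under eq_fun do rewrite [X in X * _]/(- f0 _) mulNr; exact: vanishing_opp.
  exact: stein_pos df kB van x0.
move=> df kB van x; have [x0|x0|->] := ltrgtP x 0; last first.
- by rewrite mul0r normr0; exact: le_trans (kB 0).
- exact: pos df kB van _ x0.
- rewrite -normrN -mulNr -[x in f x]opprK.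
  apply: (pos (fun t => f (- t)) (fun t => - k (- t))); last by rewrite oppr_gt0.
  + move=> t; have dft := df (- t).
    have dn : is_derive t 1 (-%R : R -> R) (- 1) by exact: is_deriveNid.
    have := @is_derive1_comp R f -%R t _ _ dft dn.
    by rewrite /comp => d; apply: is_derive_eq; rewrite mulrN1 mulNr opprD opprK.
  + by move=> t; rewrite normrN.
  + have := vanishing_reflect van.
    by under eq_fun do rewrite gaussN.
Qed.

Section stein_solution_bounds.
Context (f k : R -> R) (B : R).
Context (df : forall t, is_derive t 1 f (t * f t + k t))
  (kB : forall t, `|k t| <= B) (van : vanishing (fun t => f t * gauss t)).

Lemma stein_derive_bound x : `|x * f x + k x| <= 2 * B.
Proof.
apply: le_trans (ler_normD _ _) _.
by have := stein_mul_bound df kB van x; have := kB x; lra.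
Qed.

Lemma stein_increment a b : a <= b -> `|f b - f a| <= 2 * B * (b - a).
Proof.
move=> ab.
have [c _ ->] :=
  mean_value (df := fun t => t * f t + k t) ab (fun x _ _ => df x).
rewrite normrM (ger0_norm (_ : 0 <= b - a)) ?subr_ge0 //.
by rewrite ler_wpM2r ?subr_ge0 // stein_derive_bound.
Qed.

(** Away from [-1, 1] this is [stein_mul_bound]; inside, the derivative bound carries
    the value from an endpoint. *)
Lemma stein_bound x : `|f x| <= 3 * B.
Proof.
have B0 : 0 <= B by exact: le_trans (kB 0).
have mb := stein_mul_bound df kB van.
have [x1|x1] := leP 1 `|x|.
  have := mb x; rewrite normrM.
  have : 1 * `|f x| <= `|x| * `|f x| by rewrite ler_wpM2r.
  lra.
move: x1; rewrite ltr_norml => /andP[xm xp].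
have [x0|x0] := leP 0 x.
  have := mb 1; rewrite mul1r => f1; have := stein_increment (ltW xp).
  have : B * (1 - x) <= B * 1 by apply: ler_wpM2l => //; lra.
  by move: f1; rewrite !ler_norml => /andP[? ?] ? /andP[? ?]; apply/andP; split; lra.
have := mb (- 1); rewrite mulN1r normrN => f1; have := stein_increment (ltW xm).
have : B * (x - - 1) <= B * 1 by apply: ler_wpM2l => //; lra.
by move: f1; rewrite !ler_norml => /andP[? ?] ? /andP[? ?]; apply/andP; split; lra.
Qed.

End stein_solution_bounds.

(** An increment of [f] solves the same equation with a right-hand side of the
    size of the step, so the bound on the derivative of solutions bounds the
    increments of the derivative of [f]. *)
Lemma stein_derive_lipschitz f k (L : R) :
  (forall t, is_derive t 1 f (t * f t + k t)) -> (forall t, `|k t| <= 1) ->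
  vanishing (fun t => f t * gauss t) ->
  (forall s t, `|k s - k t| <= L * `|s - t|) ->
  forall s t, `|(s * f s + k s) - (t * f t + k t)| <= 2 * (3 + L) * `|s - t|.
Proof.
move=> df k1 van kL s t; set d := s - t.
have fb x : `|f x| <= 3 by have := stein_bound df k1 van x; rewrite mulr1.
pose F x := f (x + d) - f x.
pose K x := d * f (x + d) + (k (x + d) - k x).
have dF x : is_derive x 1 F (x * F x + K x).
  have d1 := df (x + d); have d2 := df x.
  have d3 : is_derive x 1 (fun z => f (z + d)) ((x + d) * f (x + d) + k (x + d)).
    have dd : is_derive x 1 (fun z : R => z + d) 1.
      by have -> : (fun z : R => z + d) = id + cst d by [];
        apply: is_derive_eq; rewrite addr0.
    have := @is_derive1_comp R f (fun z => z + d) x _ _ d1 dd.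
    by rewrite mulr1.
  have EF : F = (fun z => f (z + d)) - f by [].
  by rewrite [X in is_derive _ _ X]EF; apply: is_derive_eq; rewrite /F /K; ring.
have Kb x : `|K x| <= (3 + L) * `|d|.
  apply: le_trans (ler_normD _ _) _; rewrite [X in _ <= X]mulrDl; apply: lerD.
    by rewrite normrM mulrC ler_wpM2r.
  by have := kL (x + d) x; rewrite addrAC subrr add0r.
have vF : vanishing (fun x => F x * gauss x).
  apply: (@vanishing_gauss _ 6) => x; apply: le_trans (ler_normB _ _) _.
  by have := fb (x + d); have := fb x; lra.
have := stein_derive_bound dF Kb vF t; rewrite mulrA.
by rewrite /F /K /d (addrC t) subrK; congr (`|_| <= _); ring.
Qed.

Lemma stein_taylor f k (L : R) :
  (forall t, is_derive t 1 f (t * f t + k t)) -> (forall t, `|k t| <= 1) ->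
  vanishing (fun t => f t * gauss t) ->
  (forall s t, `|k s - k t| <= L * `|s - t|) ->
  forall w w', `|f w' - f w - (w * f w + k w) * (w' - w)|
     <= 2 * (3 + L) * (w' - w) ^+ 2.
Proof.
move=> df k1 van kL w w'.
have lip := stein_derive_lipschitz df k1 van kL.
have L0 : 0 <= 2 * (3 + L).
  by have := lip 1 0; rewrite subr0 normr1 mulr1; exact: le_trans.
pose g t := t * f t + k t.
suff [c cw E] : exists2 c, `|c - w| <= `|w' - w| & f w' - f w = g c * (w' - w).
  rewrite E -mulrBl normrM -real_normK ?num_real // expr2 mulrA ler_wpM2r //.
  by apply: le_trans (lip _ _) _; rewrite ler_wpM2l.
have [ww|/ltW ww] := leP w w'.
  have [c /andP[wc cw'] E] := mean_value (df := g) ww (fun x _ _ => df x).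
  by exists c => //; rewrite !ger0_norm ?subr_ge0 // lerD2r.
have [c /andP[wc cw'] E] := mean_value (df := g) ww (fun x _ _ => df x).
exists c; first by rewrite !ler0_norm ?subr_le0 // lerN2 lerD2r.
by rewrite -opprB E -mulrN opprB.
Qed.

End gauss.


(** * Stein's equation for smoothed half-line indicators *)

Section gauss_cdf.
Context (R : realType).
Let mu := @lebesgue_measure R.

Definition gauss_integral (h : R -> R) (x : R) : R :=
  \int[mu]_(t in `]-oo, x]) (h t * gauss t).

Section bounded_weight.
Context (h : R -> R) (hcont : continuous h) (h01 : forall t, 0 <= h t <= 1).

Lemma gauss_continuous : continuous (@gauss R).
Proof. by apply: continuous_normal_pdf; rewrite oner_eq0. Qed.

Lemma integrable_weighted_gauss (D : set R) : measurable D ->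
  mu.-integrable D (EFin \o (fun t => h t * gauss t)).
Proof.
move=> mD; apply: (@integrableS _ _ _ mu setT) => //.
apply: (le_integrable _ _ _ (integrable_normal_pdf 0 (1 : R))) => //.
  apply/measurable_EFinP; apply: continuous_measurable_fun => t.
  by apply: cvgM; [exact: hcont | exact: gauss_continuous].
move=> t _ /=; rewrite lee_fin.
have /andP[h0 h1] := h01 t; have g0 := ltW (gauss_gt0 t).
rewrite !ger0_norm ?mulr_ge0 //.
by rewrite -[X in _ <= X]mul1r ler_wpM2r.
Qed.

Lemma is_derive_gauss_integral (x : R) :
  is_derive x 1 (gauss_integral h) (h x * gauss x).
Proof.
have x1 : x < x + 1 by rewrite ltrDl.
have [] := @continuous_FTC1 R (fun t => h t * gauss t) -oo%O x (x + 1) x1.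
- by apply: integrable_weighted_gauss; exact: measurable_itv.
- by rewrite ltNyr.
- by apply: cvgM; [exact: hcont | exact: gauss_continuous].
- by move=> d e; apply: DeriveDef => //; rewrite -derive1E.
Qed.

Lemma gauss_integral_ge0 x : 0 <= gauss_integral h x.
Proof.
apply: Rintegral_ge0 => t _; have /andP[h0 _] := h01 t.
by rewrite mulr_ge0 // ltW // gauss_gt0.
Qed.

End bounded_weight.

Definition gauss_cdf (x : R) : R := gauss_integral (fun=> 1) x.

Lemma gauss_cdfE x :
  gauss_cdf x = fine (normal_prob 0 1 [set t : R | t <= x]).
Proof.
rewrite /gauss_cdf /gauss_integral /Rintegral /normal_prob; congr fine.
rewrite set_itvE; apply: eq_integral => t _.
by rewrite mul1r.
Qed.

Lemma gauss_integral_le_cdf (h : R -> R) x : continuous h -> (forall t, 0 <= h t <= 1) ->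
  gauss_integral h x <= gauss_cdf x.
Proof.
move=> hc h01; apply: le_Rintegral => //.
- exact: integrable_weighted_gauss.
- by apply: integrable_weighted_gauss => // t; [exact: cvg_cst | rewrite ler01 lexx].
- move=> t _; have /andP[_ h1] := h01 t.
  by rewrite ler_wpM2r // ltW // gauss_gt0.
Qed.

Let idR : measurableTypeR R -> R := idfun.

HB.instance Definition _ :=
  @isMeasurableFun.Build _ _ _ _ idR (@measurable_id _ _ setT).

Let P : probability (measurableTypeR R) R := normal_prob 0 1.

Let gauss_cdf_cdf x : (gauss_cdf x)%:E = cdf (idR : {RV P >-> R}) x.
Proof.
rewrite gauss_cdfE /cdf /distribution /pushforward /=.
have -> : [set t : R | t <= x] = `]-oo, x]%classic by rewrite set_itvE.
by rewrite fineK // (fin_num_measure P).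
Qed.

Let gauss_cdf_fine : gauss_cdf = fine \o cdf (idR : {RV P >-> R}).
Proof. by apply/funext => x; exact: (congr1 fine (gauss_cdf_cdf x)). Qed.

Lemma gauss_cdf_ge0 x : 0 <= gauss_cdf x.
Proof. by apply: gauss_integral_ge0 => t; rewrite ler01 lexx. Qed.

Lemma gauss_cdf_le1 x : gauss_cdf x <= 1.
Proof. by rewrite -lee_fin gauss_cdf_cdf cdf_le1. Qed.

Lemma gauss_cdf_Ny (e : R) : 0 < e -> exists M, forall x, x <= M -> gauss_cdf x <= e.
Proof.
move=> e0; have : gauss_cdf x @[x --> -oo] --> (0 : R).
  rewrite gauss_cdf_fine; apply: fine_cvg.
  exact: (cvg_cdfNy0 (idR : {RV P >-> R})).
move=> /cvgrPdist_le/(_ e e0)[M [_ HM]]; exists (M - 1) => x xM.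
have /HM : x < M by apply: le_lt_trans xM _; rewrite ltrBlDr ltrDl.
by rewrite sub0r normrN ger0_norm ?gauss_cdf_ge0.
Qed.

Lemma gauss_cdf_y (e : R) : 0 < e ->
  exists M, forall x, M <= x -> 1 - gauss_cdf x <= e.
Proof.
move=> e0; have : gauss_cdf x @[x --> +oo] --> (1 : R).
  rewrite gauss_cdf_fine; apply: fine_cvg.
  exact: (cvg_cdfy1 (idR : {RV P >-> R})).
move=> /cvgrPdist_le/(_ e e0)[M [_ HM]]; exists (M + 1) => x xM.
have /HM : M < x by apply: lt_le_trans xM; rewrite ltrDl.
by rewrite ger0_norm // subr_ge0 gauss_cdf_le1.
Qed.

Lemma is_derive_gauss_cdf (x : R) : is_derive x 1 gauss_cdf (gauss x).
Proof.
rewrite -[gauss x]mul1r; apply: is_derive_gauss_integral => t.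
  exact: cvg_cst.
by rewrite ler01 lexx.
Qed.

Lemma gauss_cdf_lipschitz (x e : R) : 0 <= e -> gauss_cdf (x + e) <= gauss_cdf x + e.
Proof.
move=> e0; have xe : x <= x + e by rewrite lerDl.
have [c _] := mean_value (df := @gauss R) xe (fun t _ _ => is_derive_gauss_cdf t).
move/eqP; rewrite subr_eq => /eqP ->; rewrite addrC lerD2l addrAC subrr add0r.
by rewrite -[X in _ <= X]mul1r ler_wpM2r // gauss_le1.
Qed.

Definition ramp (z e t : R) : R := Num.max 0 (Num.min 1 ((z + e - t) / e)).

Section ramp.
Context (z e : R) (e0 : 0 < e).

Lemma ramp01 t : 0 <= ramp z e t <= 1.
Proof. by rewrite /ramp le_max lexx /= ge_max ler01 ge_min lexx. Qed.

Lemma ramp_left t : t <= z -> ramp z e t = 1.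
Proof.
move=> tz; rewrite /ramp min_l ?max_r //.
by rewrite ler_pdivlMr // mul1r; lra.
Qed.

Lemma ramp_right t : z + e <= t -> ramp z e t = 0.
Proof.
move=> tz; rewrite /ramp max_l // ge_min; apply/orP; right.
by rewrite ler_pdivrMr // mul0r; lra.
Qed.

Lemma ramp_lipschitz s t : `|ramp z e s - ramp z e t| <= e^-1 * `|s - t|.
Proof.
set u := (z + e - s) / e; set v := (z + e - t) / e.
have -> : e^-1 * `|s - t| = `|u - v|.
  rewrite -[e^-1]gtr0_norm ?invr_gt0 // -normrM -normrN; congr `|_|.
  by rewrite /u /v; field; rewrite gt_eqF.
rewrite /ramp -/u -/v.
have clamp (a : R) : [\/ a <= 0 /\ Num.max 0 (Num.min 1 a) = 0,
   0 <= a <= 1 /\ Num.max 0 (Num.min 1 a) = a |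
   1 <= a /\ Num.max 0 (Num.min 1 a) = 1].
  have /orP[a0|a0] := le_total a 0.
    by apply: Or31; split=> //; rewrite max_l // ge_min a0 orbT.
  have /orP[a1|a1] := le_total a 1.
    by apply: Or32; split; [rewrite a0 | rewrite min_r // max_r].
  by apply: Or33; split; [| rewrite min_l ?max_r].
have Nle (a b : R) : - b <= a -> a <= b -> `|a| <= b by rewrite ler_norml => -> ->.
have /orP[uv|uv] := le_total u v.
  rewrite (ler0_norm (x := u - v)) ?subr_le0 //.
  by case: (clamp u) => -[? ->]; case: (clamp v) => -[? ->]; apply: Nle; lra.
rewrite (ger0_norm (x := u - v)) ?subr_ge0 //.
by case: (clamp u) => -[? ->]; case: (clamp v) => -[? ->]; apply: Nle; lra.
Qed.

Lemma ramp_continuous : continuous (ramp z e).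
Proof.
move=> t; apply/cvgrPdist_le => d d0.
near=> s; apply: le_trans (ramp_lipschitz _ _) _.
rewrite mulrC ler_pdivrMr //.
near: s; apply/nbhs_ballP; exists (d * e) => /=; first exact: mulr_gt0.
by move=> s /ltW.
Unshelve. all: by end_near. Qed.

Let J := gauss_integral (ramp z e).
Let N := J (z + e).

Let is_derive_J (x : R) : is_derive x 1 J (ramp z e x * gauss x).
Proof. exact: is_derive_gauss_integral ramp_continuous ramp01 x. Qed.

Let J_ge0 x : 0 <= J x. Proof. exact: gauss_integral_ge0 ramp01 x. Qed.

Let J_le_cdf x : J x <= gauss_cdf x.
Proof. exact: gauss_integral_le_cdf ramp_continuous ramp01. Qed.

(** J and the distribution function agree at - oo and have the same derivative up to
    z. *)
Let J_left : J z = gauss_cdf z.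
Proof.
apply/eqP; rewrite eq_le J_le_cdf /=; apply/ler_addgt0Pr => d d0.
have [M HM] := gauss_cdf_Ny d0.
pose x := Num.min z M.
have xz : x <= z by rewrite ge_min lexx.
have /HM xd : x <= M by rewrite ge_min lexx orbT.
have d2 t : x <= t -> t <= z -> is_derive t 1 (gauss_cdf - J) 0.
  move=> _ tz; have := is_derive_gauss_cdf t; have := is_derive_J t.
  rewrite ramp_left // mul1r => dJ dC.
  by apply: is_derive_eq; rewrite subrr.
have [c _] := mean_value (df := fun=> 0) xz d2.
rewrite mul0r /= => /eqP; rewrite subr_eq0 => /eqP.
rewrite -![(_ - _ : R -> R) _]/(_ - _) => E.
by have := J_ge0 x; lra.
Qed.

Let J_right x : z + e <= x -> J x = N.
Proof.
move=> zx.
have d2 t : z + e <= t -> t <= x -> is_derive t 1 J 0.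
  by move=> zt _; have := is_derive_J t; rewrite ramp_right // mul0r.
have [c _] := mean_value (df := fun=> 0) zx d2.
by rewrite mul0r => /eqP; rewrite subr_eq0 => /eqP.
Qed.

Let N_bounds : gauss_cdf z <= N <= gauss_cdf z + e.
Proof.
apply/andP; split; last first.
  by apply: le_trans (J_le_cdf _) _; apply: gauss_cdf_lipschitz; exact: ltW.
rewrite -J_left; apply: (nondecreasing_derive (df := fun t => ramp z e t * gauss t)).
- by rewrite lerDl ltW.
- by move=> t _ _; exact: is_derive_J.
- by move=> t _ _; rewrite mulr_ge0 // ?(ltW (gauss_gt0 t)) //; case/andP: (ramp01 t).
Qed.

(** The solution given by the integrating factor [gauss]: J - N Phi is the integral
    over (- oo, x] of the centred ramp against the Gaussian density. *)
Let f (x : R) : R := (J x - N * gauss_cdf x) / gauss x.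
Let k (x : R) : R := ramp z e x - N.

Let fgauss x : f x * gauss x = J x - N * gauss_cdf x.
Proof. by rewrite /f mulfVK // gt_eqF // gauss_gt0. Qed.

Let is_derive_f (x : R) : is_derive x 1 f (x * f x + k x).
Proof.
have g0 : gauss x != 0 by rewrite gt_eqF // gauss_gt0.
have dg := is_derive_gauss x.
have dV := is_deriveV g0 dg.
have dJ := is_derive_J x; have dC := is_derive_gauss_cdf x.
have Ef : f = (J - N *: gauss_cdf) * (fun y => (gauss y)^-1) by [].
rewrite [X in is_derive _ _ X]Ef; apply: is_derive_eq.
rewrite /GRing.scale /= /f /k -[(_ - _ : R -> R) x]/(J x - N * gauss_cdf x).
by field.
Qed.

Let N01 : 0 <= N <= 1.
Proof. by rewrite J_ge0 (le_trans (J_le_cdf _)) // gauss_cdf_le1. Qed.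

Let k_le1 t : `|k t| <= 1.
Proof.
have /andP[? ?] := ramp01 t; have /andP[? ?] := N01.
by rewrite ler_norml /k; apply/andP; split; lra.
Qed.

Let vanishing_f : vanishing (fun t => f t * gauss t).
Proof.
move=> d d0; have [M1 H1] := gauss_cdf_Ny d0; have [M2 H2] := gauss_cdf_y d0.
exists (`|M1| + `|M2| + `|z + e|) => x Mx; rewrite fgauss.
have /andP[N0 N1] := N01; have C0 := gauss_cdf_ge0 x; have C1 := gauss_cdf_le1 x.
have [x0|x0] := leP 0 x.
  have zx : z + e <= x.
    rewrite (ger0_norm x0) in Mx; apply: le_trans Mx.
    by rewrite (le_trans (ler_norm _)) // lerDr addr_ge0.
  have /H2 C2 : M2 <= x.
    rewrite (ger0_norm x0) in Mx; apply: le_trans Mx.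
    by apply: le_trans (ler_norm M2) _; rewrite -addrA addrCA lerDl addr_ge0.
  rewrite J_right // -{1}[N]mulr1 -mulrBr ger0_norm ?mulr_ge0 ?subr_ge0 //.
  by apply: le_trans C2; rewrite ler_piMl // subr_ge0.
have /H1 C2 : x <= M1.
  rewrite (ltr0_norm x0) in Mx.
  have := ler_norm (- M1); rewrite normrN.
  have : 0 <= `|M2| by [].
  have : 0 <= `|z + e| by [].
  by lra.
have := J_ge0 x; have := J_le_cdf x.
have : N * gauss_cdf x <= 1 * gauss_cdf x by apply: ler_wpM2r.
have : 0 <= N * gauss_cdf x by exact: mulr_ge0.
by move=> ? ? ? ?; rewrite ler_norml; apply/andP; split; lra.
Qed.

(** Stein's equation for [ramp z e], with the regularity of its solution
    needed for a second-order expansion. *)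
Lemma ramp_stein_solution : e <= 1 -> exists (f g : R -> R) (N : R),
  [/\ forall w, ramp z e w - N = g w - w * f w,
      forall w, `|g w| <= 2,
      forall w w', `|f w' - f w - g w * (w' - w)| <= 8 / e * (w' - w) ^+ 2 &
      gauss_cdf z <= N <= gauss_cdf z + e].
Proof.
move=> e1; exists f, (fun x => x * f x + k x), N; split=> // [w|w|w w'].
- by rewrite /k; ring.
- by have := stein_derive_bound is_derive_f k_le1 vanishing_f w; rewrite mulr1.
apply: le_trans (stein_taylor (L := e^-1) is_derive_f k_le1 vanishing_f _ w w') _.
  move=> s t; rewrite /k (_ : _ - _ - _ = ramp z e s - ramp z e t); last by ring.
  exact: ramp_lipschitz.
apply: ler_wpM2r; first exact: sqr_ge0.
have : 1 <= e^-1 by rewrite invf_ge1.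
lra.
Qed.

End ramp.

End gauss_cdf.


(** * Uniform vectors on the slice as random rearrangements *)

Section slice.
Context (R : realType) (n : nat) (s : R).
Implicit Types (x : 'cV[R]_n) (g : 'cV[R]_n -> R).

Definition permute_col x (p : 'S_n) : 'cV[R]_n := \col_v x (p v) 0.

Lemma slice_permute x p : slice n s x -> slice n s (permute_col x p).
Proof.
move=> [x1 xs]; split=> [i|]; first by rewrite mxE.
rewrite -xs; congr (_%:R); rewrite -[RHS](card_preimset _ (@perm_inj _ p)).
by apply: eq_card => i; rewrite !inE mxE.
Qed.

Lemma permute_colK p : cancel (permute_col^~ p) (permute_col^~ p^-1%g).
Proof. by move=> x; apply/colP => i; rewrite !mxE permKV. Qed.

Lemma permute_colM x p r : permute_col (permute_col x p) r = permute_col x (r * p)%g.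
Proof. by apply/colP => i; rewrite !mxE permM. Qed.

Lemma slice_finite : finite_set (slice n s).
Proof.
pose h (b : {ffun 'I_n -> bool}) : 'cV[R]_n := \col_i (if b i then 1 else - 1).
apply: (@sub_finite_set _ _ (h @` setT)); last first.
  by apply: finite_image; exact: finite_finset.
move=> x [x1 _]; exists [ffun i => x i 0 == 1] => //.
apply/colP => i; rewrite mxE ffunE; case: eqP => [->//|].
by case: (x1 i) => [->//|->].
Qed.

Lemma slice_transitive x x' : slice n s x -> slice n s x' ->
  exists p, x' = permute_col x p.
Proof.
move=> [x1 xs] [x1' xs'].
pose b (z : 'cV[R]_n) : n.-tuple bool := [tuple z i 0 == 1 | i < n].
have cnt (z : 'cV[R]_n) : count_mem true (b z) = #|[set i | z i 0 == 1]%SET|.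
  rewrite count_map cardE /enum_mem size_filter -enumT.
  by apply: eq_count => i; rewrite /= eqb_id -[RHS]/(i \in [set j | z j 0 == 1]%SET) inE.
have ones : count_mem true (b x') = count_mem true (b x).
  by apply/eqP; rewrite !cnt -(eqr_nat R) xs xs'.
have cntF (t : n.-tuple bool) : count_mem false t = (n - count_mem true t)%N.
  rewrite -[X in (X - _)%N](size_tuple t) -(count_predC (pred1 true) t) addKn.
  by apply: eq_count => -[].
have /tuple_permP[p E] : perm_eq (b x') (b x).
  have h c : count_mem c (b x') = count_mem c (b x) by case: c; rewrite ?cntF ones.
  by apply/allP => c _; apply/eqP; exact: h.
exists p; apply/colP => i; rewrite mxE.
have : tnth (b x') i = tnth (b x) (p i).
  have -> : b x' = [tuple tnth (b x) (p i) | i < n] by exact: val_inj.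
  by rewrite tnth_mktuple.
rewrite !tnth_mktuple.
case: (x1' i) (x1 (p i)) => -> [] -> //; rewrite eqxx.
  by move/eqP.
by move/esym/eqP ->.
Qed.

Lemma slice_neq0 : 0 <= s -> s <= 1 -> s * n%:R \is a Num.int ->
  exists x, slice n s x.
Proof.
move=> s0 s1 /intrP[z sz].
have z0 : (0 <= z)%R by rewrite -(ler_int R) -sz mulr_ge0.
case: z z0 sz => // k _; rewrite -pmulrn => sk.
have kn : (k <= n)%N by rewrite -(ler_nat R) -sk ler_piMl.
exists (\col_i (if (i < k)%N then 1 else - 1)); split=> [i|].
  by rewrite mxE; case: ifP; [right | left].
rewrite sk; congr (_%:R).
transitivity (\sum_(i < n | (i < k)%N) 1)%N; last first.
  by rewrite -(big_ord_widen _ (fun=> 1%N) kn) sum1_card card_ord.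
rewrite sum1_card; apply: eq_card => i; rewrite !inE mxE.
case: ifP => [ik|ik]; first by rewrite eqxx [RHS]ik.
rewrite [RHS]ik; apply/negbTE; rewrite lt_eqF //; lra.
Qed.

Lemma slice_sum x : slice n s x -> \sum_v (x v 0 - (2 * s - 1)) = 0.
Proof.
move=> [x1 xs].
have E v : x v 0 = 2 * (x v 0 == 1)%:R - 1.
  case: (x1 v) => ->; last by rewrite eqxx mulr1n; lra.
  have -> : (-1 == 1 :> R) = false by apply/negbTE; rewrite lt_eqF //; lra.
  by rewrite mulr0n mulr0 sub0r.
rewrite sumrB; under eq_bigr do rewrite E.
rewrite sumrB -mulr_sumr !sumr_const card_ord.
have -> : \sum_(i < n) (x i 0 == 1)%:R = s * n%:R :> R.
  rewrite -xs -sum1_card natr_sum [RHS]big_mkcond /=.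
  by apply: eq_bigr => i _; rewrite inE; case: eqP.
rewrite -[1 *+ n]mulr_natr -[(_ - _) *+ n]mulr_natr; ring.
Qed.

Lemma slice_sqr x v : slice n s x -> (x v 0 - (2 * s - 1) + (2 * s - 1)) ^+ 2 = 1.
Proof. by move=> [x1 _]; rewrite subrK; case: (x1 v) => ->; rewrite ?sqrrN expr1n. Qed.

(** The slice is a single orbit of S_n: permuting coordinates preserves sums over
    it, and all its points have the same average over their rearrangements. *)
Lemma slice_mean g x0 : slice n s x0 ->
  (\sum_(x <- fset_set (slice n s)) g x) / #|` fset_set (slice n s)|%:R
  = perm_mean (fun p => g (permute_col x0 p)).
Proof.
move=> Sx0; set S := fset_set (slice n s).
have inS x : (x \in S) = `[< slice n s x >].
  by rewrite in_fset_set ?inE //; exact: slice_finite.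
have inSP x : x \in S -> slice n s x by rewrite inS => /asboolP.
have card0 : (0 < #|` S|)%N.
  by rewrite cardfs_gt0; apply/fset0Pn; exists x0; rewrite inS; apply/asboolP.
have shift p : \sum_(x <- S) g x = \sum_(x <- S) g (permute_col x p).
  rewrite -[RHS](big_map (permute_col^~ p) xpredT g); apply: perm_big.
  apply: uniq_perm; first exact: fset_uniq.
    by rewrite map_inj_uniq ?fset_uniq //; exact: can_inj (permute_colK p).
  move=> x; apply/idP/mapP => [Sx|[z Sz ->]]; last first.
    by rewrite inS; apply/asboolP/slice_permute/inSP.
  exists (permute_col x p^-1%g).
    by rewrite inS; apply/asboolP/slice_permute/inSP.
  by rewrite permute_colM mulgV; apply/colP => i; rewrite mxE perm1.
have E x : x \in S -> perm_mean (fun p => g (permute_col x p)) =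
    perm_mean (fun p => g (permute_col x0 p)).
  move=> /inSP/(slice_transitive Sx0)[r ->]; rewrite /perm_mean; congr (_ / _).
  under eq_bigr do rewrite permute_colM.
  by rewrite [RHS](reindex_inj (mulIg r)).
have -> : \sum_(x <- S) g x = \sum_(x <- S) perm_mean (fun p => g (permute_col x p)).
  rewrite /perm_mean -mulr_suml exchange_big /=.
  transitivity ((\sum_(p : 'S_n) \sum_(x <- S) g x) / n`!%:R).
    by rewrite sumr_const card_Sn -[X in X / _]mulr_natr mulfK // gt_eqF // fact_gt0R.
  by congr (_ / _); apply: eq_bigr => p _; exact: shift.
rewrite (eq_big_seq _ E) big_const_seq count_predT iter_addr addr0.
rewrite -[_ *+ _]mulr_natr mulfK // pnatr_eq0 -lt0n.
exact: card0.
Qed.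

End slice.


Section uniform_slice.
Context (R : realType) (n : nat) (s : R) (disp : measure_display)
  (T : measurableType disp) (P : probability T R) (X : 'I_n -> {RV P >-> R}).
Context (unif : uniform_on P (slice n s) X) (x0 : 'cV[R]_n) (Sx0 : slice n s x0).

Let S := fset_set (slice n s).
Let B (x : 'cV[R]_n) := [set t | random_vector X t = x].
Let U := \big[setU/set0]_(x <- S) B x.

Let inS x : x \in S -> slice n s x.
Proof. by rewrite in_fset_set ?inE //; exact: slice_finite. Qed.

Let card_gt0 : 0 < #|` S|%:R :> R.
Proof.
rewrite ltr0n cardfs_gt0; apply/fset0Pn; exists x0.
by rewrite in_fset_set ?inE //; exact: slice_finite.
Qed.

Let measurable_B x : measurable (B x).
Proof.
have -> : B x = \bigcap_(i in [set: 'I_n]) (X i @^-1` [set x i 0]).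
  apply/seteqP; split=> [t tx i _ /=|t tx]; first by rewrite -tx mxE.
  by apply/colP => i; rewrite mxE; exact: (tx i).
apply: fin_bigcap_measurable => [|i _]; first exact: finite_finset.
rewrite -[X in measurable X]setTI; exact: measurable_funP.
Qed.

Let measurable_U : measurable U.
Proof. by apply: bigsetU_measurable => x _; exact: measurable_B. Qed.

Let integral_U (f : T -> R) (g : 'cV[R]_n -> R) :
  measurable_fun setT f -> (forall t, f t = g (random_vector X t)) ->
  (\int[P]_(t in U) (f t)%:E)%E = ((\sum_(x <- S) g x) / #|` S|%:R)%:E.
Proof.
move=> mf fg; rewrite integral_bigsetU_EFin //.
- rewrite mulr_suml -sumEFin big_seq [RHS]big_seq; apply: eq_bigr => x xS.
  transitivity (\int[P]_(t in B x) (g x)%:E)%E.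
    by apply: eq_integral => t; rewrite inE fg => ->.
  rewrite integral_cst // EFinM; congr (_ * _)%E.
  exact: unif (inS xS).
- by move=> x y _ _ [t [<- <-]].
- by apply/measurable_EFinP; exact: measurable_funTS.
Qed.

(** The hypothesis prescribes only the point masses; they add up to 1. *)
Let P_setC_U : P (~` U) = 0%E.
Proof.
rewrite probability_setC //.
have := @integral_U (cst 1) (fun=> 1) (measurable_cst _) (fun=> erefl).
have -> : (\int[P]_(t in U) (cst 1%R t)%:E = P U)%E.
  by rewrite -[RHS]mul1e -(integral_cst P measurable_U 1%E).
move=> ->.
rewrite big_const_seq count_predT iter_addr addr0 -[_ *+ _]mulr_natr mul1r.
by rewrite mulfV ?gt_eqF // subee.
Qed.

Lemma uniform_expectation (f : T -> R) (g : 'cV[R]_n -> R) :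
  measurable_fun setT f -> (forall t, f t = g (random_vector X t)) ->
  'E_P[f]%E = (perm_mean (fun p => g (permute_col x0 p)))%:E.
Proof.
move=> mf fg; rewrite unlock -(slice_mean g Sx0) -(integral_U mf fg).
have mfE : measurable_fun setT (EFin \o f) by exact/measurable_EFinP.
rewrite -(setUv U) integral_setU //.
- rewrite [X in (_ + X)%E](_ : _ = 0%E) ?adde0 //.
  apply: null_set_integral => //; first exact: measurableC.
  exact: measurable_funTS.
- exact: measurableC.
- exact: measurable_funTS.
- by rewrite disj_set2E setICr.
Qed.

Lemma uniform_probability (A : set T) (b : 'cV[R]_n -> bool) : measurable A ->
  (forall t, A t <-> b (random_vector X t)) ->
  P A = (perm_mean (fun p => (b (permute_col x0 p))%:R))%:E.
Proof.
move=> mA Ab; rewrite -expectation_indic //.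
apply: (uniform_expectation (f := \1_A) (g := fun z => (b z)%:R)) => [|t].
  exact: measurable_indic.
rewrite indicE.
by congr (_%:R); congr nat_of_bool; apply/idP/idP; rewrite inE Ab.
Qed.

End uniform_slice.


(** * The quadratic form of a regular graph *)

Section graph_law.
Context (R : realType) (n d : nat) (e : rel 'I_n) (s : R).
Context (reg : regular_graph d e).

Definition adj (i j : 'I_n) : R := (e i j)%:R.

Lemma adj_sym i j : adj i j = adj j i.
Proof. by case: reg => -[sym _] _; rewrite /adj sym. Qed.

Lemma adj_diag i : adj i i = 0.
Proof. by case: reg => -[_ irr] _; rewrite /adj irr. Qed.

Lemma adj_idem i j : adj i j * adj i j = adj i j.
Proof. by rewrite /adj; case: (e i j); rewrite ?mulr1 ?mulr0. Qed.

Lemma adj_degree i : \sum_j adj i j = d%:R.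
Proof.
case: reg => _ /(_ i) <-; rewrite -sum1_card natr_sum [RHS]big_mkcond /=.
by apply: eq_bigr => j _; rewrite inE /adj; case: (e i j).
Qed.

Lemma degree_le : (0 < n)%N -> d%:R <= n%:R :> R.
Proof.
move=> n0; case: reg => _ /(_ (Ordinal n0)) <-.
by rewrite ler_nat -[X in (_ <= X)%N](card_ord n) max_card.
Qed.

Let m : R := 2 * s - 1.

Definition centered (x : 'cV[R]_n) : 'I_n -> R := fun v => x v 0 - m.

Lemma centered_permute x p : centered (permute_col x p) = rearranged (centered x) p.
Proof. by apply/funext => v; rewrite /centered /rearranged mxE. Qed.

Lemma quadratic_form_centered (x : 'cV[R]_n) : \sum_v centered x v = 0 ->
  2^-1 * (x^T *m adjacency_matrix R e *m x) 0 0 =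
  graph_form adj (centered x) + 2^-1 * m ^+ 2 * n%:R * d%:R.
Proof.
move=> x0; rewrite mxE; set y := centered x in x0 *.
have xy v : x v 0 = y v + m by rewrite /y /centered subrK.
have E v : (x^T *m adjacency_matrix R e) 0 v = nbr_sum adj y v + m * d%:R.
  rewrite mxE -(adj_degree v) mulr_sumr -big_split; apply: eq_bigr => k _ /=.
  by rewrite !mxE xy -/(adj k v) adj_sym; ring.
have [N EN] : exists N, N = nbr_sum adj y by exists (nbr_sum adj y).
transitivity (2^-1 * (\sum_v y v * N v + m * d%:R * \sum_v y v + m * \sum_v N v
   + m ^+ 2 * d%:R * n%:R)).
  have -> : n%:R = \sum_(v < n) 1 :> R by rewrite sumr_const card_ord.
  rewrite !mulr_sumr -!big_split /=.
  rewrite mulr_sumr; apply: eq_bigr => v _.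
  by rewrite E xy -EN; ring.
rewrite EN (sum_nbr_sum adj_sym adj_degree) x0 /graph_form; ring.
Qed.

Context (disp : measure_display) (T : measurableType disp)
  (P : probability T R) (X : 'I_n -> {RV P >-> R}).
Context (unif : uniform_on P (slice n s) X) (x0 : 'cV[R]_n) (Sx0 : slice n s x0).

Let y := centered x0.
Let q (p : 'S_n) := graph_form adj (rearranged y p).
Let c : R := 2^-1 * m ^+ 2 * n%:R * d%:R.
Let Q := quadratic_form (adjacency_matrix R e) X.

Lemma centered_sum0 : \sum_v y v = 0. Proof. exact: slice_sum Sx0. Qed.

Lemma centered_sq v : (y v + m) ^+ 2 = 1. Proof. exact: slice_sqr Sx0. Qed.

Let gQ (x : 'cV[R]_n) : R := 2^-1 * (x^T *m adjacency_matrix R e *m x) 0 0.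

Let gQE p : gQ (permute_col x0 p) = q p + c.
Proof.
rewrite /gQ quadratic_form_centered ?centered_permute //.
by rewrite (sum_rearranged id) centered_sum0.
Qed.

Lemma expectation_quadratic_form : 'E_P[Q]%E = (perm_mean q + c)%:E.
Proof.
rewrite (uniform_expectation unif Sx0 (g := gQ)) //; congr (_%:E).
under eq_perm_mean do rewrite gQE.
by rewrite perm_meanD perm_mean_cst.
Qed.

Lemma variance_quadratic_form : 'V_P[Q]%E = (form_variance adj y)%:E.
Proof.
rewrite /variance unlock expectation_quadratic_form /=.
rewrite (uniform_expectation unif Sx0
  (g := fun x => (gQ x - (perm_mean q + c)) * (gQ x - (perm_mean q + c)))) //.
  congr (_%:E); apply: eq_perm_mean => p.
  transitivity ((q p - perm_mean q) ^+ 2); last by [].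
  by rewrite gQE; ring.
Qed.

Lemma distribution_standardize z :
  fine (distribution P (standardize P Q) [set x | x <= z]) =
  perm_mean (fun p => ((q p - perm_mean q) / Num.sqrt (form_variance adj y) <= z)%R%:R).
Proof.
rewrite /distribution /pushforward.
rewrite (uniform_probability unif Sx0 (b := fun x =>
  (gQ x - (perm_mean q + c)) / Num.sqrt (form_variance adj y) <= z)) //=.
- apply: eq_perm_mean => p; rewrite gQE; congr ((_ / _ <= _)%R%:R).
  by ring.
- rewrite -[X in measurable X]setTI.
  apply: (measurable_funP (standardize P Q)) => //.
  have -> : [set x | x <= z] = `]-oo, z]%classic by rewrite set_itvE.
  exact: measurable_itv.
- move=> t; rewrite /preimage /= /standardize.
  by rewrite expectation_quadratic_form variance_quadratic_form.
Qed.

End graph_law.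


(** * Kolmogorov distance *)

(** The indicator of a half-line lies between the ramps starting at [z - e] and at
    [z], whose Gaussian means differ from the distribution function at [z] by at
    most [e], the Gaussian density being at most 1. *)
Lemma kolmogorov_of_stein (R : realType) (n : nat) (W : 'S_n -> R) (e c : R) :
  0 < e -> e <= 1 ->
  (forall f g : R -> R, (forall w, `|g w| <= 2) ->
    (forall w w', `|f w' - f w - g w * (w' - w)| <= 8 / e * (w' - w) ^+ 2) ->
    `|perm_mean (fun p => g (W p) - W p * f (W p))| <= c) ->
  forall z, `|perm_mean (fun p => (W p <= z)%R%:R) - gauss_cdf z| <= e + c.
Proof.
move=> e0 e1 stein z.
have ramp_mean t : exists2 N, `|perm_mean (fun p => ramp t e (W p)) - N| <= c &
    gauss_cdf t <= N <= gauss_cdf t + e.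
  have [f [g [N [fg gB fT NB]]]] := ramp_stein_solution t e0 e1.
  exists N => //; apply: le_trans (stein f g gB fT).
  rewrite -[N in X in X <= _](perm_mean_cst n) -perm_meanB.
  by under eq_perm_mean do rewrite fg.
rewrite ler_norml; apply/andP; split.
  have [N] := ramp_mean (z - e); rewrite ler_norml => /andP[h1 _] /andP[h2 _].
  have := gauss_cdf_lipschitz (z - e) (ltW e0); rewrite subrK => h3.
  have : perm_mean (fun p => ramp (z - e) e (W p)) <=
      perm_mean (fun p => (W p <= z)%R%:R).
    apply: perm_mean_le => p; have /andP[_ r1] := ramp01 (z - e) e (W p).
    case: (leP (W p) z) => [//|/ltW zW].
    by rewrite ramp_right // subrK.
  lra.
have [N] := ramp_mean z; rewrite ler_norml => /andP[_ h1] /andP[_ h2].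
have : perm_mean (fun p => (W p <= z)%R%:R) <=
    perm_mean (fun p => ramp z e (W p)).
  apply: perm_mean_le => p; have /andP[r0 _] := ramp01 z e (W p).
  by case: (leP (W p) z) => [Wz|//]; rewrite ramp_left.
lra.
Qed.

Lemma variance_factor (R : realFieldType) (s : R) :
  1 - (2 * s - 1) ^+ 2 = 4 * s * (1 - s).
Proof. by ring. Qed.

Lemma variance_factor_ge (R : realFieldType) (delta s : R) :
  0 < delta -> delta < s -> s < 1 - delta ->
  4 * delta ^+ 2 <= 1 - (2 * s - 1) ^+ 2.
Proof.
move=> d0 ds s1; rewrite variance_factor -mulrA ler_pM2l // expr2.
by apply: ler_pM; lra.
Qed.

Lemma quarter_root (R : realType) (a : R) : 0 < a ->
  (a `^ 4^-1) ^+ 4 = a.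
Proof.
by move=> a0; rewrite -powR_mulrn ?powR_ge0 // -powRrM mulVf ?powRr1 ?ltW.
Qed.

Section slice_bounds.
Context (R : realType) (n d : nat) (g : rel 'I_n) (s r0 : R).
Context (reg : regular_graph d g).
Context (disp : measure_display) (T : measurableType disp)
  (P : probability T R) (X : 'I_n -> {RV P >-> R}).
Context (unif : uniform_on P (slice n s) X) (x0 : 'cV[R]_n) (Sx0 : slice n s x0).
Let rho := 1 - (2 * s - 1) ^+ 2.
Let Q := quadratic_form (adjacency_matrix R g) X.

Lemma cdf_quadratic_form_le : (6 <= n)%N -> (0 < d)%N -> 0 < r0 -> r0 <= rho ->
  220 * d%:R <= n%:R * r0 ^+ 2 :> R ->
  forall z, `|fine (distribution P (standardize P Q) [set x | x <= z])
              - fine (normal_prob 0 1 [set x : R | x <= z])|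
    <= (1 + (14 * 100 ^+ 3 / r0 ^+ 2 + 192 / r0)) * ((d%:R / n%:R) `^ 4^-1).
Proof.
move=> n6 d0 r0p r0rho small z; set e := _ `^ _.
have n6' : 6 <= n%:R :> R by rewrite (ler_nat R 6 n).
have d1 : 1 <= d%:R :> R by rewrite (ler_nat R 1 d).
have dn : d%:R <= n%:R :> R by apply: (degree_le R reg); exact: leq_trans n6.
have np : 0 < n%:R :> R by lra.
have a0 : 0 < d%:R / n%:R :> R by apply: divr_gt0; lra.
have e4 : e ^+ 4 = d%:R / n%:R by exact: quarter_root.
have e0 : 0 < e by exact: powR_gt0.
have e1 : e <= 1.
  have : e ^+ 4 <= 1 by rewrite e4 ler_pdivrMr // mul1r.
  by rewrite expr_le1 // ltW.
rewrite -gauss_cdfE (distribution_standardize reg unif Sx0) [X in _ <= X]mulrDl mul1r.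
apply: kolmogorov_of_stein => // f h hB fT.
have rhop : 0 < rho by exact: lt_le_trans r0rho.
have r2 : r0 ^+ 2 <= rho ^+ 2 by rewrite ler_sqr ?nnegrE // ltW.
have small' : 220 * d%:R <= n%:R * rho ^+ 2 :> R.
  by apply: le_trans small _; apply: ler_wpM2l => //; exact: ltW.
apply: le_trans (stein_graph_form (adj_sym R reg) (adj_diag R reg) (adj_idem R g)
  (adj_degree R reg) (centered_sum0 Sx0) (centered_sq Sx0) n6 d1 dn erefl rhop
  small' e0 e4 hB fT) _.
rewrite -/rho.
have -> : (7 * 100 ^+ 3 / rho ^+ 2 * 2 + 24 / rho * (8 / e)) * e ^+ 2 =
  (14 * 100 ^+ 3 / rho ^+ 2) * (e * e) + (192 / rho) * e.
  by field; rewrite (gt_eqF rhop) (gt_eqF e0).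
have i2 : 14 * 100 ^+ 3 / rho ^+ 2 <= 14 * 100 ^+ 3 / r0 ^+ 2.
  by rewrite ler_pM2l ?lef_pV2 ?posrE ?exprn_gt0 //; lra.
have i1 : 192 / rho <= 192 / r0 by rewrite ler_pM2l ?lef_pV2 ?posrE.
rewrite [X in _ <= X]mulrDl; apply: lerD; last by apply: ler_wpM2r => //; exact: ltW.
apply: ler_pM => //.
- by apply: divr_ge0; [lra | exact: sqr_ge0].
- by apply: mulr_ge0; exact: ltW.
- by rewrite ler_piMl // ltW.
Qed.

End slice_bounds.

Theorem theorem5p1 (R : realType) (delta : R) (hdelta : 0 < delta) :
  exists K C : R, forall d : nat -> nat,
    (fun n : nat => (d n)%:R : R^o) =o_\oo (fun n : nat => n%:R : R^o) ->
    (\forall n \near \oo,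
      forall (e : rel 'I_n) (s : R)
        (disp : measure_display) (T : measurableType disp)
        (P : probability T R) (X : 'I_n -> {RV P >-> R}),
      regular_graph (d n) e ->
      delta < s -> s < 1 - delta -> s * n%:R \is a Num.int ->
      uniform_on P (slice n s) X ->
      exists2 eps : R,
        fine 'V_P[quadratic_form (adjacency_matrix R e) X] =
          8 * n%:R * (d n)%:R * s ^+ 2 * (1 - s) ^+ 2 * (1 + eps) &
        `|eps| <= K * ((d n)%:R / n%:R))
    /\
    (forall (n : nat) (e : rel 'I_n) (s : R)
        (disp : measure_display) (T : measurableType disp)
        (P : probability T R) (X : 'I_n -> {RV P >-> R}),
      (0 < n)%N -> (0 < d n)%N ->
      regular_graph (d n) e ->
      delta < s -> s < 1 - delta -> s * n%:R \is a Num.int ->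
      uniform_on P (slice n s) X ->
      dKS (distribution P (standardize P (quadratic_form (adjacency_matrix R e) X)))
          (normal_prob 0 1)
        <= C * ((d n)%:R / n%:R) `^ 4^-1).
Proof.
pose r0 := 4 * delta ^+ 2.
have r0p : 0 < r0 by rewrite mulr_gt0 // exprn_gt0.
(* The last summand of C makes the bound trivial when d / n is not small. *)
exists (110 / r0 ^+ 2),
  (1 + (14 * 100 ^+ 3 / r0 ^+ 2 + 192 / r0) + 220 / r0 ^+ 2) => d _; split.
  exists 6%N => // n n6 e s disp T P X reg ds s1 sn unif.
  have [x0 Sx0] : exists x0, slice n s x0 by apply: slice_neq0 => //; lra.
  have r0rho := variance_factor_ge hdelta ds s1.
  set rho := 1 - _ in r0rho.
  have rhoE : rho = 4 * s * (1 - s) by exact: variance_factor.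
  rewrite (variance_quadratic_form reg unif Sx0) /=.
  have n6' : 6 <= n%:R :> R by rewrite (ler_nat R 6 n).
  have [d0|d0] := posnP (d n).
    exists 0; rewrite ?normr0 d0 ?mul0r ?mulr0 //.
    have a0 i j : adj R e i j = 0.
      case: reg => _ /(_ i); rewrite d0 => /eqP; rewrite cards_eq0 => /eqP ei0.
      have : j \notin [set j | e i j]%SET by rewrite ei0 inE.
      by rewrite inE /adj => /negbTE ->.
    have q0 y : graph_form (adj R e) y = 0.
      rewrite /graph_form big1 ?mulr0 // => v _.
      by rewrite /nbr_sum big1 ?mulr0 // => k _; rewrite a0 mul0r.
    rewrite /form_variance -[RHS](perm_mean_cst n); apply: eq_perm_mean => p.
    under eq_perm_mean do rewrite q0.
    by rewrite q0 perm_mean_cst subrr expr0n !mul0r.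
  have d1 : 1 <= (d n)%:R :> R by rewrite (ler_nat R 1).
  have m1 : (2 * s - 1) ^+ 2 <= 1.
    by rewrite -subr_ge0 -/rho (le_trans (ltW r0p)).
  have := form_variance_bound (adj_sym R reg) (adj_diag R reg) (adj_idem R e)
    (adj_degree R reg) (centered_sum0 Sx0) (centered_sq Sx0) n6 m1 d1.
  rewrite -/rho; set V := form_variance _ _ => VB.
  set D : R := (d n)%:R in d1 VB *.
  have rhop : 0 < rho by exact: lt_le_trans r0rho.
  have M0 : 0 < 2^-1 * n%:R * D * rho ^+ 2.
    by rewrite !mulr_gt0 ?invr_gt0 ?exprn_gt0 //; lra.
  exists (V / (2^-1 * n%:R * D * rho ^+ 2) - 1).
    have -> : 8 * n%:R * D * s ^+ 2 * (1 - s) ^+ 2 = 2^-1 * n%:R * D * rho ^+ 2.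
      by rewrite rhoE; field.
    by rewrite addrC subrK mulrC mulfVK // gt_eqF.
  have -> : V / (2^-1 * n%:R * D * rho ^+ 2) - 1 =
     (V - 2^-1 * n%:R * D * rho ^+ 2) / (2^-1 * n%:R * D * rho ^+ 2).
    by rewrite mulrBl mulfV // gt_eqF.
  rewrite normrM normfV (gtr0_norm M0) ler_pdivrMr //.
  apply: le_trans VB _.
  have r2 : r0 ^+ 2 <= rho ^+ 2 by rewrite ler_sqr ?nnegrE // ltW.
  have -> : 110 / r0 ^+ 2 * (D / n%:R) * (2^-1 * n%:R * D * rho ^+ 2) =
    55 * D ^+ 2 * (rho ^+ 2 / r0 ^+ 2).
    by field; rewrite (gt_eqF r0p) /=; apply/eqP; lra.
  apply: ler_peMr; first by apply: mulr_ge0 => //; exact: sqr_ge0.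
  by rewrite ler_pdivlMr ?exprn_gt0 // mul1r.
move=> n e s disp T P X n0 d0 reg ds s1 sn unif.
have [x0 Sx0] : exists x0, slice n s x0 by apply: slice_neq0 => //; lra.
have r0rho := variance_factor_ge hdelta ds s1.
have rho1 : r0 <= 1.
  by apply: le_trans r0rho _; have := sqr_ge0 (2 * s - 1); lra.
have np : 0 < n%:R :> R by rewrite ltr0n.
have dp : 0 < (d n)%:R :> R by rewrite ltr0n.
have dn : (d n)%:R <= n%:R :> R by exact: (degree_le R reg n0).
have a0 : 0 < (d n)%:R / n%:R :> R by exact: divr_gt0.
set ep := _ `^ _.
have ep0 : 0 < ep by exact: powR_gt0.
have r2p : 0 < r0 ^+ 2 by rewrite exprn_gt0.
apply: ge_sup; first by apply: image_nonempty; exists 0.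
move=> _ [z _ <-].
have [small|large] := leP (220 * (d n)%:R : R) (n%:R * r0 ^+ 2).
  have n6 : (6 <= n)%N.
    rewrite -(ler_nat R); have : n%:R * r0 ^+ 2 <= n%:R * 1.
      by apply: ler_wpM2l; [exact: ltW | rewrite expr_le1 // ltW].
    have : 1 <= (d n)%:R :> R by rewrite (ler_nat R 1).
    lra.
  apply: le_trans (cdf_quadratic_form_le reg unif Sx0 n6 d0 r0p r0rho small z) _.
  by rewrite -/ep ler_pM2r // lerDl divr_ge0 // ltW.
have e4 : ep ^+ 4 = (d n)%:R / n%:R by exact: quarter_root.
have ep1 : ep <= 1.
  have : ep ^+ 4 <= 1 by rewrite e4 ler_pdivrMr // mul1r.
  by rewrite expr_le1 // ltW.
apply: (@le_trans _ _ 1).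
  rewrite -gauss_cdfE (distribution_standardize reg unif Sx0).
  set F := perm_mean _.
  have F0 : 0 <= F by apply: perm_mean_ge0 => p; rewrite ler0n.
  have F1 : F <= 1.
    rewrite -[X in _ <= X](perm_mean_cst n); apply: perm_mean_le => p.
    by rewrite lern1 leq_b1.
  have := gauss_cdf_ge0 z; have := gauss_cdf_le1 z.
  by move=> ? ?; rewrite ler_norml; apply/andP; split; lra.
have big : 1 <= 220 / r0 ^+ 2 * ep.
  apply: (@le_trans _ _ (220 / r0 ^+ 2 * ep ^+ 4)).
    rewrite e4 (_ : _ * _ = 220 * (d n)%:R / (n%:R * r0 ^+ 2)).
      by rewrite ler_pdivlMr ?mulr_gt0 // mul1r ltW.
    by field; rewrite (gt_eqF r0p) (gt_eqF np).
  apply: ler_wpM2l; first by rewrite divr_ge0 // ltW.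
  have ep3 : ep ^+ 3 <= 1 by rewrite expr_le1 // ltW.
  by rewrite exprS; apply: ler_piMr => //; exact: ltW.
apply: le_trans big _; rewrite ler_pM2r // lerDr.
by rewrite !addr_ge0 // divr_ge0 // ?mulr_ge0 ?exprn_ge0 // ltW.
Qed.
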